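(* Let $B=A^{coH}\subseteq A$ be a quantum principal bundle with a complete differential calculus $\Omega^\bullet(A)$. Then the vertical forms $\mathrm{ver}^\bullet(A)$ are complete, i.e. the right $H$-coaction $\Delta_A:A\to A\otimes H$ extends to a morphism $\Delta_{\mathrm{ver}}^\wedge:\mathrm{ver}^\bullet(A)\to\mathrm{ver}^\bullet(A)\otimes\Omega^\bullet(H)$ of differential graded algebras. Moreover, $\Delta_{\mathrm{ver}}^\wedge\circ\pi_{\mathrm{ver}}=(\pi_{\mathrm{ver}}\otimes\mathrm{id})\circ\Delta_A^\wedge$ as maps $\Omega^\bullet(A)\to\mathrm{ver}^\bullet(A)\otimes\Omega^\bullet(H)$.
   Context: Work over a field $\mathbb{k}$; $H$ is a Hopf algebra with coproduct $\Delta(h)=h_1\otimes h_2$, counit $\epsilon$, antipode $S$; right coactions are written $a\mapsto a_0\otimes a_1$, iterated $a_0\otimes a_1\otimes a_2$. A differential calculus on an algebra $A$ is a differential $\mathbb{N}_0$-graded algebra $(\Omega^\bullet,\wedge,\mathrm{d})$ with $\Omega^0=A$ and $\Omega^k=\mathrm{span}\{a^0\mathrm{d}a^1\wedge\cdots\wedge\mathrm{d}a^k\}$. Tensor products of differential graded algebras carry the product $(\omega\otimes\eta)(\omega'\otimes\eta')=(-1)^{|\eta||\omega'|}(\omega\wedge\omega')\otimes(\eta\wedge\eta')$ and the differential $\mathrm{d}\otimes\mathrm{id}+(-1)^{|\cdot|}\mathrm{id}\otimes\mathrm{d}$. Standing assumptions: $(\Gamma,\mathrm{d})$ is a bicovariant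 first order calculus on $H$ and $\Omega^\bullet(H)=\Gamma^\wedge$ its maximal prolongation (tensor algebra of $\Gamma$ over $H$ modulo the ideal generated by $\sum_i\mathrm{d}a^i\otimes_H\mathrm{d}b^i$ whenever $\sum_ia^i\mathrm{d}b^i=0$), such that $\Delta$ extends to a morphism of differential graded algebras $\Delta^\bullet:\Omega^\bullet(H)\to\Omega^\bullet(H)\otimes\Omega^\bullet(H)$. A quantum principal bundle is a faithfully flat Hopf-Galois extension $B=A^{coH}\subseteq A$ of a right $H$-comodule algebra $A$. A differential calculus $\Omega^\bullet(A)$ is complete if $\Delta_A:A\to A\otimes H$ extends to a morphism of differential graded algebras $\Delta_A^\wedge:\Omega^\bullet(A)\to\Omega^\bullet(A)\otimes\Omega^\bullet(H)$. $\Lambda^\bullet\subseteq\Omega^\bullet(H)$ is the subalgebra of left $H$-coinvariant forms, a right $H$-module via $\theta\leftharpoonup h=S(h_1)\theta h_2$. Put $\pi_\epsilon(h)=h-\epsilon(h)1$ and $\varpi(h)=S(h_1)\mathrm{d}h_2$. Vertical forms are the differential calculus $\mathrm{ver}^\bullet(A)=A\otimes\Lambda^\bullet$ on $A$ with product $(a\otimes\theta)\wedge_{\mathrm{ver}}(b\otimes\eta)=ab_0\otimes(\theta\leftharpoonup b_1)\wedge\eta$ and differential $\mathrm{d}_{\mathrm{ver}}(a\otimes\theta)=a\otimes\mathrm{d}\theta+a_0\otimes\varpi(\pi_\epsilon(a_1))\wedge\theta$. The map $\pi_{\mathrm{ver}}:\Omega^\bullet(A)\to\mathrm{ver}^\bullet(A)$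 is the surjective morphism of differential graded algebras extending $\mathrm{id}_A$, explicitly $\pi_{\mathrm{ver}}(a^0\mathrm{d}a^1\wedge\cdots\wedge\mathrm{d}a^k)=a^0_0a^1_0\cdots a^k_0\otimes S(a^0_1a^1_1\cdots a^k_1)a^0_2\mathrm{d}a^1_2\wedge\cdots\wedge\mathrm{d}a^k_2$. *)

(* Defs.v *)
From HB Require Import structures.
From mathcomp Require Import all_boot all_algebra.
From mathcomp Require Import boolp classical_sets fsbigop.
From mathcomp Require Import zify.

Set Implicit Arguments.
Unset Strict Implicit.
Unset Printing Implicit Defensive.

Import GRing.Theory.
Local Open Scope ring_scope.
Local Open Scope quotient_scope.

(** * Balanced tensor products *)

(** [btensor r l] is the abelian group M (x)_I N: finite formal sums of pairs
    (m, n) : M * N, modulo biadditivity and the relations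
    (r m i, n) = (m, l i n) for i : I.  Two formal sums are identified exactly
    when no biadditive balanced map can tell them apart. *)
Section BalancedTensor.
Variables (I : Type) (M N : zmodType) (r : M -> I -> M) (l : I -> N -> N).

Definition balanced (W : zmodType) (f : M -> N -> W) : Prop :=
  [/\ forall m m' n, f (m + m') n = f m n + f m' n,
      forall m n n', f m (n + n') = f m n + f m n'
    & forall m i n, f (r m i) n = f m (l i n)].

Definition formal_sum (W : zmodType) (f : M -> N -> W) (s : seq (M * N)) : W :=
  \sum_(p <- s) f p.1 p.2.

Definition btensor_rel (s t : seq (M * N)) : bool :=
  `[< forall (W : zmodType) (f : M -> N -> W),
        balanced f -> formal_sum f s = formal_sum f t >].

Lemma btensor_rel_equiv : equiv_class_of btensor_rel.
Proof.
split=> [s|s t|t s u] //=; first by apply/asboolP.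
  by apply/asboolP/asboolP => h W f bf; rewrite h.
by move=> /asboolP h1 /asboolP h2; apply/asboolP => W f bf; rewrite h1 ?h2.
Qed.
Canonical btensor_equiv := EquivRelPack btensor_rel_equiv.

Definition btensor : Type := {eq_quot btensor_equiv}.
HB.instance Definition _ := Choice.on btensor.
HB.instance Definition _ := EqQuotient.on btensor.

Definition btens (m : M) (n : N) : btensor := \pi_btensor [:: (m, n)].

(** The additive map induced by [f]; meaningful when [f] is balanced. *)
Definition blift (W : zmodType) (f : M -> N -> W) (x : btensor) : W :=
  formal_sum f (repr x).

Lemma blift_pi (W : zmodType) (f : M -> N -> W) s :
  balanced f -> blift f (\pi_btensor s) = formal_sum f s.
Proof.
move=> bf; rewrite /blift; case: piP => t /eqmodP /asboolP h.
by rewrite (h _ _ bf).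
Qed.

Lemma btensor_ext (x y : btensor) :
  (forall (W : zmodType) (f : M -> N -> W), balanced f -> blift f x = blift f y) ->
  x = y.
Proof.
move=> h; rewrite -[x]reprK -[y]reprK; apply/eqmodP/asboolP => W f bf.
exact: h.
Qed.

Lemma blift_btens (W : zmodType) (f : M -> N -> W) m n :
  balanced f -> blift f (btens m n) = f m n.
Proof. by move=> bf; rewrite blift_pi // /formal_sum big_seq1. Qed.

Let add (x y : btensor) : btensor := \pi_btensor (repr x ++ repr y).
Let opp (x : btensor) : btensor :=
  \pi_btensor [seq (- p.1, p.2) | p <- repr x].
Let zero : btensor := \pi_btensor [::].

Let balN (W : zmodType) (f : M -> N -> W) m n :
  balanced f -> f (- m) n = - f m n.
Proof.
case=> fD _ _; apply: (addIr (f m n)).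
rewrite -fD !addNr; apply: (addIr (f 0 n)).
by rewrite -fD !add0r.
Qed.

Let blift_add (W : zmodType) (f : M -> N -> W) x y :
  balanced f -> blift f (add x y) = blift f x + blift f y.
Proof. by move=> bf; rewrite blift_pi // /formal_sum big_cat. Qed.

Let blift_opp (W : zmodType) (f : M -> N -> W) x :
  balanced f -> blift f (opp x) = - blift f x.
Proof.
move=> bf; rewrite blift_pi // /formal_sum big_map -sumrN.
by apply: eq_bigr => p _; exact: balN.
Qed.

Let blift_zero (W : zmodType) (f : M -> N -> W) :
  balanced f -> blift f zero = 0.
Proof. by move=> bf; rewrite blift_pi // /formal_sum big_nil. Qed.

Fact btensor_addA : associative add.
Proof. by move=> x y z; apply: btensor_ext => W f bf; rewrite !blift_add // addrA. Qed.
Fact btensor_addC : commutative add.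
Proof. by move=> x y; apply: btensor_ext => W f bf; rewrite !blift_add // addrC. Qed.
Fact btensor_add0 : left_id zero add.
Proof.
by move=> x; apply: btensor_ext => W f bf; rewrite !blift_add // blift_zero ?add0r.
Qed.
Fact btensor_addN : left_inverse zero opp add.
Proof.
move=> x; apply: btensor_ext => W f bf.
by rewrite blift_add // blift_opp // blift_zero // addNr.
Qed.

HB.instance Definition _ := GRing.isZmodule.Build btensor
  btensor_addA btensor_addC btensor_add0 btensor_addN.

Lemma bliftD (W : zmodType) (f : M -> N -> W) x y :
  balanced f -> blift f (x + y) = blift f x + blift f y.
Proof. exact: blift_add. Qed.

Lemma btens_balanced : balanced btens.
Proof.
split=> *; apply: btensor_ext => W f bf; rewrite ?bliftD ?blift_btens //;
  by case: bf.
Qed.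

Lemma btensorE (x : btensor) : x = \sum_(p <- repr x) btens p.1 p.2.
Proof.
apply: btensor_ext => W f bf; rewrite {1}/blift /formal_sum.
elim: (repr x) => [|p s IHs]; first by rewrite !big_nil blift_zero.
by rewrite !big_cons bliftD // blift_btens // IHs.
Qed.

End BalancedTensor.

Arguments btens {I M N} r l m n.
Arguments blift {I M N r l W} f x.

(** * Tensor products over a field *)

Section Tensor.
Variables (k : fieldType) (U V : lmodType k).

Definition tensor : Type :=
  btensor (fun (u : U) (c : k) => c *: u) (fun (c : k) (v : V) => c *: v).
HB.instance Definition _ := GRing.Zmodule.on tensor.

Definition tens (u : U) (v : V) : tensor :=
  btens (fun (u : U) (c : k) => c *: u) (fun (c : k) (v : V) => c *: v) u v.

Definition bilin (W : lmodType k) (f : U -> V -> W) : Prop :=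
  (forall v, linear (f^~ v)) /\ (forall u, linear (f u)).

(** The linear map induced by [f]; meaningful when [f] is bilinear. *)
Definition tlift (W : zmodType) (f : U -> V -> W) (x : tensor) : W := blift f x.

Let tbalanced (W : zmodType) (f : U -> V -> W) :=
  balanced (fun (u : U) (c : k) => c *: u) (fun (c : k) (v : V) => c *: v) f.

Let tens_bal : tbalanced tens.
Proof. exact: btens_balanced. Qed.

Let scaled_bal c : tbalanced (fun u v => tens (c *: u) v).
Proof.
have [hl hr hb] := tens_bal; split=> *; rewrite ?scalerDr ?hl ?hr //.
by rewrite scalerA mulrC -scalerA hb.
Qed.

Let scale (c : k) (x : tensor) : tensor := tlift (fun u v => tens (c *: u) v) x.

Let tadditive_ext (W : zmodType) (f g : tensor -> W) :
  {morph f : x y / x + y} -> {morph g : x y / x + y} ->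
  (forall u v, f (tens u v) = g (tens u v)) -> f =1 g.
Proof.
move=> fD gD h x.
have f0 : f 0 = 0 by apply: (addIr (f 0)); rewrite -fD !add0r.
have g0 : g 0 = 0 by apply: (addIr (g 0)); rewrite -gD !add0r.
rewrite [x]btensorE (big_morph f fD f0) (big_morph g gD g0).
by apply: eq_bigr => p _; exact: h.
Qed.

Let scaleD c : {morph scale c : x y / x + y}.
Proof. by move=> x y; exact: (bliftD _ _ (scaled_bal c)). Qed.

Let scale_tens c u v : scale c (tens u v) = tens (c *: u) v.
Proof. exact: (blift_btens _ _ (scaled_bal c)). Qed.

Fact tensor_scalerA a b x : scale a (scale b x) = scale (a * b) x.
Proof.
move: x; apply: tadditive_ext => [x y|x y|u v]; rewrite ?scaleD //.
by rewrite !scale_tens scalerA.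
Qed.
Fact tensor_scale1r : left_id 1 scale.
Proof.
move=> x; move: x; apply: tadditive_ext => [x y|x y|u v]; rewrite ?scaleD //.
by rewrite scale_tens scale1r.
Qed.
Fact tensor_scalerDr : right_distributive scale +%R.
Proof. by move=> c x y; exact: scaleD. Qed.
Fact tensor_scalerDl x : {morph scale^~ x : a b / a + b}.
Proof.
move=> a b; move: x.
apply: (@tadditive_ext _ _ (fun x => scale a x + scale b x)) => [x y|x y|u v].
- exact: scaleD.
- by rewrite !scaleD addrACA.
- by rewrite !scale_tens scalerDl; case: tens_bal.
Qed.
HB.instance Definition _ := GRing.Zmodule_isLmodule.Build k tensor
  tensor_scalerA tensor_scale1r tensor_scalerDr tensor_scalerDl.

Lemma tens_bilin : bilin tens.
Proof.
have [hl hr hb] := tens_bal; split=> [v c u u'|u c v v'].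
  by rewrite hl; congr (_ + _); rewrite -scale_tens.
rewrite hr; congr (_ + _); change (tens u (c *: v) = scale c (tens u v)).
by rewrite scale_tens hb.
Qed.

Let bilin_bal (W : lmodType k) (f : U -> V -> W) : bilin f -> tbalanced f.
Proof.
move=> [hl hr]; split=> [m m' n|m n n'|m c n].
- by have := hl n 1 m m'; rewrite /= !scale1r.
- by have := hr m 1 n n'; rewrite !scale1r.
- have l0 : f 0 n = 0.
    by have := hl n (-1) m m; rewrite /= !scaleN1r !addNr.
  have r0 : f m 0 = 0 by have := hr m (-1) n n; rewrite !scaleN1r !addNr.
  have /= := hl n c m 0; rewrite !addr0 l0 addr0 => ->.
  by have := hr m c n 0; rewrite !addr0 r0 addr0 => ->.
Qed.

Lemma tlift_tens (W : lmodType k) (f : U -> V -> W) u v :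
  bilin f -> tlift f (tens u v) = f u v.
Proof. by move/bilin_bal => bf; exact: (blift_btens _ _ bf). Qed.

Lemma linear_tensor_ext (W : lmodType k) (f g : tensor -> W) :
  linear f -> linear g -> (forall u v, f (tens u v) = g (tens u v)) -> f =1 g.
Proof.
move=> fL gL; apply: tadditive_ext => x y.
  by have := fL 1 x y; rewrite !scale1r.
by have := gL 1 x y; rewrite !scale1r.
Qed.

Lemma tlift_linear (W : lmodType k) (f : U -> V -> W) :
  bilin f -> linear (tlift f).
Proof.
move=> bf c x y; have bbf := bilin_bal bf.
rewrite /tlift (bliftD _ _ bbf); congr (_ + _); move: x.
apply: tadditive_ext => [x x'|x x'|u v].
- by rewrite scalerDr (bliftD _ _ bbf).
- by rewrite (bliftD _ _ bbf) scalerDr.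
- change (blift f (scale c (tens u v)) = c *: blift f (tens u v)).
  rewrite scale_tens /tens !(blift_btens _ _ bbf).
  have [hl hr] := bf; have := hl v c u 0; rewrite /= !addr0 => ->.
  by have := hl v (-1) u u; rewrite /= !scaleN1r !addNr => ->; rewrite addr0.
Qed.

End Tensor.

Arguments tens {k U V} u v.
Arguments tlift {k U V W} f x.

Section TensorMaps.
Variable k : fieldType.

Definition tmap (U V U' V' : lmodType k) (f : U -> U') (g : V -> V') :
  tensor U V -> tensor U' V' := tlift (fun u v => tens (f u) (g v)).

(** The componentwise operation (u (x) v) (u' (x) v') = f u u' (x) g v v'. *)
Definition tmap2 (U V U' V' U'' V'' : lmodType k)
    (f : U -> U' -> U'') (g : V -> V' -> V'')
    (x : tensor U V) (y : tensor U' V') : tensor U'' V'' :=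
  tlift (fun u v => tmap (f u) (g v) y) x.

Definition tassoc (U V W : lmodType k) :
  tensor (tensor U V) W -> tensor U (tensor V W) :=
  tlift (fun x w => tlift (fun u v => tens u (tens v w)) x).

Lemma tmap_bilin (U V U' V' : lmodType k) (f : U -> U') (g : V -> V') :
  linear f -> linear g -> bilin (fun u v => tens (f u) (g v)).
Proof.
have [tl tr] := tens_bilin U' V'.
by move=> fL gL; split=> [v c u u'|u c v v']; rewrite ?fL ?gL ?tl ?tr.
Qed.

Lemma tmap_tens (U V U' V' : lmodType k) (f : U -> U') (g : V -> V') u v :
  linear f -> linear g -> tmap f g (tens u v) = tens (f u) (g v).
Proof. by move=> fL gL; rewrite /tmap tlift_tens //; exact: tmap_bilin. Qed.

Lemma tmap_linear (U V U' V' : lmodType k) (f : U -> U') (g : V -> V') :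
  linear f -> linear g -> linear (tmap f g).
Proof. by move=> fL gL; apply: tlift_linear; exact: tmap_bilin. Qed.

Lemma tmap2_bilin (U V U' V' U'' V'' : lmodType k)
    (f : U -> U' -> U'') (g : V -> V' -> V'') :
  bilin f -> bilin g -> bilin (tmap2 f g).
Proof.
have [tl tr] := tens_bilin U'' V''; move=> [fl fr] [gl gr].
have mL u v : linear (tmap (f u) (g v)) by exact: tmap_linear.
have bm y : bilin (fun u v => tmap (f u) (g v) y).
  split=> [v c u u'|u c v v']; move: y.
    apply: linear_tensor_ext => [|a x y|u1 v1]; first exact: mL.
      by rewrite !mL !scalerDr !scalerA mulrC addrACA.
    rewrite !tmap_tens //; first by rewrite fl tl.
  apply: linear_tensor_ext => [|a x y|u1 v1]; first exact: mL.
    by rewrite !mL !scalerDr !scalerA mulrC addrACA.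
  by rewrite !tmap_tens // gl tr.
split=> [y|x c y y']; first by apply: tlift_linear.
move: x; apply: linear_tensor_ext => [|a x x'|u v].
- by apply: tlift_linear.
- by rewrite /tmap2 !(tlift_linear (bm _)) !scalerDr !scalerA mulrC addrACA.
- by rewrite /tmap2 !tlift_tens // mL.
Qed.

Lemma tmap2_tens (U V U' V' U'' V'' : lmodType k)
    (f : U -> U' -> U'') (g : V -> V' -> V'') u v u' v' :
  bilin f -> bilin g ->
  tmap2 f g (tens u v) (tens u' v') = tens (f u u') (g v v').
Proof.
move=> bf bg; have [fl fr] := bf; have [gl gr] := bg.
rewrite /tmap2 tlift_tens; first by rewrite tmap_tens.
have [tl tr] := tens_bilin U'' V''.
have mL a b : linear (tmap (f a) (g b)) by exact: tmap_linear.
split=> [b c a a'|a c b b']; rewrite !tmap_tens //; first by rewrite fl tl.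
by rewrite gl tr.
Qed.

End TensorMaps.

(** * Hopf algebras and comodule algebras *)

Section Hopf.
Variable k : fieldType.

Definition amul (A A' : algType k) : tensor A A' -> tensor A A' -> tensor A A' :=
  tmap2 *%R *%R.

Record hopf_axioms (H : algType k) (D : H -> tensor H H) (e : H -> k)
    (S : H -> H) : Prop := HopfAxioms {
  hopf_Delta_linear : linear D;
  hopf_Delta1 : D 1 = tens 1 1;
  hopf_DeltaM : forall g h, D (g * h) = amul (D g) (D h);
  hopf_eps_linear : linear (e : H -> k^o);
  hopf_eps1 : e 1 = 1;
  hopf_epsM : forall g h, e (g * h) = e g * e h;
  hopf_S_linear : linear S;
  hopf_coassoc : forall h, tassoc (tmap D id (D h)) = tmap id D (D h);
  hopf_counitl : forall h, tlift (fun x y => e x *: y) (D h) = h;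
  hopf_counitr : forall h, tlift (fun x y => e y *: x) (D h) = h;
  hopf_antipodel : forall h, tlift (fun x y => S x * y) (D h) = (e h)%:A;
  hopf_antipoder : forall h, tlift (fun x y => x * S y) (D h) = (e h)%:A
}.

Record hopfAlgebra := HopfAlgebra {
  hopf_alg :> algType k;
  hopf_Delta : hopf_alg -> tensor hopf_alg hopf_alg;
  hopf_eps : hopf_alg -> k;
  hopf_S : hopf_alg -> hopf_alg;
  hopf_ax : hopf_axioms hopf_Delta hopf_eps hopf_S
}.

Variable H : hopfAlgebra.

Definition left_coaction (V : lmodType k) (lam : V -> tensor H V) : Prop :=
  [/\ linear lam,
      forall v, tassoc (tmap (@hopf_Delta H) id (lam v)) = tmap id lam (lam v)
    & forall v, tlift (fun h w => hopf_eps h *: w) (lam v) = v].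

Definition right_coaction (V : lmodType k) (rho : V -> tensor V H) : Prop :=
  [/\ linear rho,
      forall v, tassoc (tmap rho id (rho v)) = tmap id (@hopf_Delta H) (rho v)
    & forall v, tlift (fun w h => hopf_eps h *: w) (rho v) = v].

Record comodAlgebra := ComodAlgebra {
  ca_alg :> algType k;
  ca_coact : ca_alg -> tensor ca_alg H;
  ca_coactP : right_coaction ca_coact;
  ca_coact1 : ca_coact 1 = tens 1 1;
  ca_coactM : forall a b, ca_coact (a * b) = amul (ca_coact a) (ca_coact b)
}.

End Hopf.

(** * Quantum principal bundles *)

Definition exact_seq (X Y Z : zmodType) (f : X -> Y) (g : Y -> Z) : Prop :=
  forall y, g y = 0 <-> exists x, f x = y.

(** M (x)_R N; right R-modules are left modules over the converse ring R^c. *)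
Definition rtensor (R : pzRingType) (M : lmodType R^c) (N : lmodType R) :=
  btensor (fun (m : M) (b : R) => (b : R^c) *: m) (fun (b : R) (n : N) => b *: n).

Definition rtensor_map (R : pzRingType) (M M' : lmodType R^c) (N : lmodType R)
    (f : M -> M') : rtensor M N -> rtensor M' N :=
  blift (fun m n => btens _ _ (f m) n).

Definition faithfully_flat (R : pzRingType) (N : lmodType R) : Prop :=
  forall (M' M M'' : lmodType R^c) (f : {linear M' -> M}) (g : {linear M -> M''}),
    exact_seq f g <-> exact_seq (@rtensor_map R M' M N f) (@rtensor_map R M M'' N g).

Section Coinvariants.
Variables (k : fieldType) (H : hopfAlgebra k) (A : comodAlgebra H).

Definition coinv : {pred A} := fun a => `[< ca_coact a = tens a 1 >].

Lemma coinvP a : reflect (ca_coact a = tens a 1) (a \in coinv).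
Proof. exact: asboolP. Qed.

Lemma amul_tens (A1 A2 : algType k) (a b : A1) (c d : A2) :
  amul (tens a c) (tens b d) = tens (a * b) (c * d).
Proof.
have mB (A' : algType k) : bilin (@GRing.mul A').
  split=> [v c0 u u'|u c0 v v']; first by rewrite mulrDl scalerAl.
  by rewrite mulrDr scalerAr.
by rewrite /amul tmap2_tens //; exact: mB.
Qed.

Fact coinv_subring : subring_closed coinv.
Proof.
have [cL _ _] := ca_coactP A; have [tl _] := tens_bilin A H.
split=> [|a b /coinvP ha /coinvP hb|a b /coinvP ha /coinvP hb]; apply/coinvP.
- exact: ca_coact1.
- have -> : a - b = (-1) *: b + a by rewrite scaleN1r addrC.
  by rewrite cL ha hb tl.
- by rewrite ca_coactM ha hb amul_tens mulr1.
Qed.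
HB.instance Definition _ := GRing.isSubringClosed.Build A coinv coinv_subring.

(** The base algebra B = A^coH. *)
Record coinvs := Coinvs { coinvs_val :> A; _ : coinvs_val \in coinv }.
HB.instance Definition _ := [isSub for coinvs_val].
HB.instance Definition _ := [Choice of coinvs by <:].
HB.instance Definition _ := [SubChoice_isSubNzRing of coinvs by <:].

(** A as a left B-module. *)
Definition lbase : Type := A.
HB.instance Definition _ := GRing.Zmodule.on lbase.

Definition lbase_scale (b : coinvs) (a : lbase) : lbase := val b * (a : A).
Fact lbase_scalerA a b v :
  lbase_scale a (lbase_scale b v) = lbase_scale (a * b) v.
Proof. by rewrite /lbase_scale rmorphM mulrA. Qed.
Fact lbase_scale1r : left_id 1 lbase_scale.
Proof. by move=> v; rewrite /lbase_scale rmorph1 mul1r. Qed.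
Fact lbase_scalerDr : right_distributive lbase_scale +%R.
Proof. by move=> b x y; rewrite /lbase_scale mulrDr. Qed.
Fact lbase_scalerDl v : {morph lbase_scale^~ v : a b / a + b}.
Proof. by move=> a b; rewrite /lbase_scale rmorphD mulrDl. Qed.
HB.instance Definition _ := GRing.Zmodule_isLmodule.Build coinvs lbase
  lbase_scalerA lbase_scale1r lbase_scalerDr lbase_scalerDl.

(** A (x)_B A and the canonical map a (x)_B a' |-> a a'_0 (x) a'_1. *)
Definition btensorA : Type :=
  btensor (fun (a : A) (b : coinvs) => a * val b)
          (fun (b : coinvs) (a : A) => val b * a).

Definition canonical_map : btensorA -> tensor A H :=
  blift (fun a a' => amul (tens a 1) (ca_coact a')).

Definition hopf_galois : Prop := bijective canonical_map.

Definition quantum_principal_bundle : Prop :=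
  hopf_galois /\ faithfully_flat lbase.

End Coinvariants.

(** * Differential graded algebras *)

Section DGA.
Variable k : fieldType.

(** The data of an N-graded algebra with a differential, the grading being
    given by the projections [dg_pr n] onto the homogeneous components. *)
Record dgdata := DGData {
  dg_car :> lmodType k;
  dg_mul : dg_car -> dg_car -> dg_car;
  dg_one : dg_car;
  dg_d : dg_car -> dg_car;
  dg_pr : nat -> dg_car -> dg_car
}.

Definition homog (E : dgdata) (n : nat) (x : E) : Prop := dg_pr n x = x.

Record dga_axioms (E : dgdata) : Prop := DGAAxioms {
  dga_mul_bilin : bilin (@dg_mul E);
  dga_mulA : associative (@dg_mul E);
  dga_mul1 : left_id (dg_one E) (@dg_mul E);
  dga_mulr1 : right_id (dg_one E) (@dg_mul E);
  dga_pr_linear : forall n, linear (@dg_pr E n);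
  dga_prK : forall m n (x : E),
    dg_pr m (dg_pr n x) = if m == n then dg_pr n x else 0;
  dga_pr_sum : forall x : E, exists N, x = \sum_(n < N) dg_pr n x;
  dga_homog1 : homog 0 (dg_one E);
  dga_homogM : forall m n (x y : E),
    homog m x -> homog n y -> homog (m + n) (dg_mul x y);
  dga_d_linear : linear (@dg_d E);
  dga_homog_d : forall n (x : E), homog n x -> homog n.+1 (dg_d x);
  dga_dd : forall x : E, dg_d (dg_d x) = 0;
  dga_leibniz : forall n (x y : E), homog n x ->
    dg_d (dg_mul x y) = dg_mul (dg_d x) y + (-1) ^+ n *: dg_mul x (dg_d y)
}.

Record dga := DGA { dga_data :> dgdata; dga_ax : dga_axioms dga_data }.

Record dg_morphism (E F : dgdata) (f : E -> F) : Prop := DGMorphism {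
  dgm_linear : linear f;
  dgm_one : f (dg_one E) = dg_one F;
  dgm_mul : forall x y, f (dg_mul x y) = dg_mul (f x) (f y);
  dgm_d : forall x, f (dg_d x) = dg_d (f x);
  dgm_pr : forall n x, f (dg_pr n x) = dg_pr n (f x)
}.

(** The degree involution x |-> (-1)^|x| x. *)
Definition dg_sign (E : dgdata) (x : E) : E :=
  \sum_(n \in [set: nat]%classic) (-1) ^+ n *: dg_pr n x.

(** (w (x) v) (w' (x) v') = (-1)^(|v| |w'|) (w w') (x) (v v'), for arbitrary
    v and w', written through their homogeneous components. *)
Definition koszul_mul (E F : dgdata) (x y : tensor E F) : tensor E F :=
  tlift (fun w v => tlift (fun w' v' =>
    \sum_(i \in [set: nat]%classic) \sum_(j \in [set: nat]%classic)
      (-1) ^+ (i * j) *: tens (dg_mul w (dg_pr j w')) (dg_mul (dg_pr i v) v'))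
    y) x.

Definition tensor_dg (E F : dgdata) : dgdata := {|
  dg_car := tensor E F;
  dg_mul := @koszul_mul E F;
  dg_one := tens (dg_one E) (dg_one F);
  dg_d := tlift (fun w v => tens (dg_d w) v + tens (dg_sign w) (dg_d v));
  dg_pr := fun n x => \sum_(i < n.+1) tmap (dg_pr i) (dg_pr (n - i)) x
|}.

End DGA.

Arguments dg_one {k E} : rename.
Arguments tensor_dg {k} E F.

(** * The tensor product of differential graded algebras is one *)

Lemma fsum_ord (V : zmodType) (F : nat -> V) N :
  (forall n, (N <= n)%N -> F n = 0) ->
  \sum_(i \in [set: nat]%classic) F i = \sum_(i < N) F i.
Proof.
move=> h; rewrite (@fsbig_ord _ _ +%R N F) -(fsbig_widen `I_N setT) //.
move=> n [_ /= /negP]; rewrite -leqNgt; exact: h.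
Qed.

Section LinearMaps.
Variables (k : fieldType) (U V : lmodType k) (f : U -> V).
Hypothesis fL : linear f.
Lemma lin0 : f 0 = 0.
Proof. by have := fL (-1) 0 0; rewrite !scaleN1r !addNr. Qed.
Lemma linD x y : f (x + y) = f x + f y.
Proof. by have := fL 1 x y; rewrite !scale1r. Qed.
Lemma linZ c x : f (c *: x) = c *: f x.
Proof. by have := fL c x 0; rewrite !addr0 lin0 addr0. Qed.
Lemma lin_sum I r (P : pred I) F : f (\sum_(i <- r | P i) F i) = \sum_(i <- r | P i) f (F i).
Proof. exact: (big_morph f linD lin0). Qed.
End LinearMaps.

Lemma linear_sumf (k : fieldType) (U V : lmodType k) I (r : seq I) (F : I -> U -> V) :
  (forall i, linear (F i)) -> linear (fun x => \sum_(i <- r) F i x).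
Proof.
move=> h c x y; rewrite scaler_sumr -big_split; apply: eq_bigr => i _; exact: h.
Qed.

Section TensorDGA.
Variables (k : fieldType) (E F : dga k).
Let axE := dga_ax E.
Let axF := dga_ax F.

Lemma pr_bound (G : dga k) (x : G) : exists N, forall n, (N <= n)%N -> dg_pr n x = 0.
Proof.
have [N e] := dga_pr_sum (dga_ax G) x; exists N => n le.
rewrite e (lin_sum (dga_pr_linear (dga_ax G) n)) big1 // => i _.
rewrite (dga_prK (dga_ax G)) gtn_eqF //; exact: leq_trans (ltn_ord i) le.
Qed.

Lemma fsum_linear (G : dga k) (V : lmodType k) (L : nat -> G -> V) :
  (forall n, linear (L n)) ->
  linear (fun x : G => \sum_(n \in [set: nat]%classic) L n (dg_pr n x)).
Proof.
move=> hL c x y; have [N hN] := pr_bound x; have [M hM] := pr_bound y.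
have pL n := dga_pr_linear (dga_ax G) n.
have hx n : (N + M <= n)%N -> dg_pr n x = 0.
  by move=> le; apply/hN/(leq_trans _ le)/leq_addr.
have hy n : (N + M <= n)%N -> dg_pr n y = 0.
  by move=> le; apply/hM/(leq_trans _ le)/leq_addl.
rewrite !(@fsum_ord _ _ (N + M)) => [|n le|n le|n le];
  rewrite ?pL ?hx ?hy ?scaler0 ?addr0 ?lin0 //.
rewrite scaler_sumr -big_split; apply: eq_bigr => n _.
by rewrite pL hL.
Qed.

Lemma fsum_hom (G : dga k) (V : lmodType k) (L : nat -> G -> V) m x :
  (forall n, linear (L n)) -> homog m x ->
  \sum_(n \in [set: nat]%classic) L n (dg_pr n x) = L m x.
Proof.
move=> hL hx.
have z n : n != m -> dg_pr n x = 0.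
  by rewrite -hx (dga_prK (dga_ax G)) => /negPf ->.
rewrite (@fsum_ord _ _ m.+1) => [|n lt].
  rewrite big_ord_recr /= big1 ?add0r ?hx // => i _.
  by rewrite z ?lin0 // ltn_eqF.
by rewrite z ?lin0 // gtn_eqF.
Qed.


Lemma bound2 (G G' : dga k) (x : G) (y : G') : exists N,
  (forall n, (N <= n)%N -> dg_pr n x = 0) /\ (forall n, (N <= n)%N -> dg_pr n y = 0).
Proof.
have [N hN] := pr_bound x; have [M hM] := pr_bound y; exists (N + M)%N.
by split=> n le; [apply: hN|apply: hM]; apply: leq_trans le; rewrite ?leq_addr ?leq_addl.
Qed.

Lemma bound3 (G G' : dga k) (x : G) (y z : G') : exists N,
  (forall n, (N <= n)%N -> dg_pr n x = 0) /\ (forall n, (N <= n)%N -> dg_pr n y = 0) /\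
  (forall n, (N <= n)%N -> dg_pr n z = 0).
Proof.
have [N [hN hM]] := bound2 x y; have [K hK] := pr_bound z; exists (N + K)%N.
split=> [n le|]; last split=> n le; [apply: hN|apply: hM|apply: hK];
 by apply: leq_trans le; rewrite ?leq_addr ?leq_addl.
Qed.

Let S (w : E) (v : F) (w' : E) (v' : F) : tensor E F :=
    \sum_(i \in [set: nat]%classic) \sum_(j \in [set: nat]%classic)
      (-1) ^+ (i * j) *: tens (dg_mul w (dg_pr j w')) (dg_mul (dg_pr i v) v').

Let tl := (tens_bilin E F).1.
Let tr := (tens_bilin E F).2.
Let El := (dga_mul_bilin axE).1.
Let Er := (dga_mul_bilin axE).2.
Let Fl := (dga_mul_bilin axF).1.
Let Fr := (dga_mul_bilin axF).2.

Lemma S_ord w v w' v' N : 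
  (forall n, (N <= n)%N -> dg_pr n v = 0) -> (forall n, (N <= n)%N -> dg_pr n w' = 0) ->
  S w v w' v' = \sum_(i < N) \sum_(j < N) 
      (-1) ^+ (i * j) *: tens (dg_mul w (dg_pr j w')) (dg_mul (dg_pr i v) v').
Proof.
move=> hv hw.
have e i : \sum_(j \in [set: nat]%classic)
      (-1) ^+ (i * j) *: tens (dg_mul w (dg_pr j w')) (dg_mul (dg_pr i v) v') = 
   \sum_(j < N) 
      (-1) ^+ (i * j) *: tens (dg_mul w (dg_pr j w')) (dg_mul (dg_pr i v) v').
  apply: fsum_ord => n le.
  by rewrite hw // (lin0 (Er w)) (lin0 (tl _)) scaler0.
rewrite /S (@fsum_ord _ _ N) => [|n le]; first by apply: eq_bigr.
rewrite e big1 // => j _.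
by rewrite hv // (lin0 (Fl _)) (lin0 (tr _)) scaler0.
Qed.

Let prE n := dga_pr_linear axE n.
Let prF n := dga_pr_linear axF n.

Lemma S_bil_r w v : bilin (S w v).
Proof.
split=> [v' c u u'|w' c u u'].
  have [N [hv [hu hu']]] := bound3 v u u'.
  rewrite !(@S_ord _ _ _ _ N) // => [|n le]; last first.
    by rewrite prE hu ?hu' // scaler0 addr0.
  rewrite scaler_sumr -big_split; apply: eq_bigr => i _.
  rewrite scaler_sumr -big_split; apply: eq_bigr => j _.
  by rewrite prE Er tl scalerDr !scalerA mulrC.
have [N [hv hu]] := bound2 v w'.
rewrite !(@S_ord _ _ _ _ N) //.
rewrite scaler_sumr -big_split; apply: eq_bigr => i _.
rewrite scaler_sumr -big_split; apply: eq_bigr => j _.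
by rewrite Fr tr scalerDr !scalerA mulrC.
Qed.

Lemma S_bil_l w' v' : bilin (fun w v => S w v w' v').
Proof.
split=> [v c u u'|w c u u'].
  have [N [hv hu]] := bound2 v w'.
  rewrite !(@S_ord _ _ _ _ N) //.
  rewrite scaler_sumr -big_split; apply: eq_bigr => i _.
  rewrite scaler_sumr -big_split; apply: eq_bigr => j _.
  by rewrite El tl scalerDr !scalerA mulrC.
have [N [hw [hu hu']]] := bound3 w' u u'.
rewrite !(@S_ord _ _ _ _ N) // => [|n le]; last first.
  by rewrite prF hu ?hu' // scaler0 addr0.
rewrite scaler_sumr -big_split; apply: eq_bigr => i _.
rewrite scaler_sumr -big_split; apply: eq_bigr => j _.
by rewrite prF Fl tr scalerDr !scalerA mulrC.
Qed.

Lemma S_bil_lift y : bilin (fun w v => tlift (S w v) y).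
Proof.
have L w v := tlift_linear (S_bil_r w v).
split=> [v c u u'|w c u u']; move: y; apply: linear_tensor_ext => [|a x y|p q]; try exact: L.
- by rewrite !L !scalerDr !scalerA mulrC addrACA.
- by rewrite !tlift_tens; try exact: S_bil_r; exact: (S_bil_l p q).1.
- by rewrite !L !scalerDr !scalerA mulrC addrACA.
- by rewrite !tlift_tens; try exact: S_bil_r; exact: (S_bil_l p q).2.
Qed.

Lemma koszul_bilin : bilin (@koszul_mul k E F).
Proof.
have L w v := tlift_linear (S_bil_r w v).
split=> [y|x]; first exact: tlift_linear (S_bil_lift y).
move=> c y y'; move: x; apply: linear_tensor_ext => [|a x x'|w v].
- exact: tlift_linear (S_bil_lift _).
- rewrite /koszul_mul !(tlift_linear (S_bil_lift _)).
  by rewrite !scalerDr !scalerA mulrC addrACA.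
- by rewrite /koszul_mul !(tlift_tens _ _ (S_bil_lift _)) L.
Qed.

Lemma koszulE (w : E) (v : F) (w' : E) (v' : F) n m :
  homog n v -> homog m w' ->
  koszul_mul (tens w v) (tens w' v') =
  (-1) ^+ (n * m) *: tens (dg_mul w w') (dg_mul v v').
Proof.
move=> hv hw'.
rewrite /koszul_mul (tlift_tens _ _ (S_bil_lift _)) (tlift_tens _ _ (S_bil_r _ _)).
have zv i : dg_pr i v = if i == n then v else 0.
  by rewrite -[in LHS]hv (dga_prK axF) hv.
have zw j : dg_pr j w' = if j == m then w' else 0.
  by rewrite -[in LHS]hw' (dga_prK axE) hw'.
rewrite (@S_ord _ _ _ _ (n + m).+1); last first.
- by move=> j le; rewrite zw gtn_eqF // (leq_trans _ le) // ltnS leq_addl.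
- by move=> i le; rewrite zv gtn_eqF // (leq_trans _ le) // ltnS leq_addr.
have nlt : (n < (n + m).+1)%N by rewrite ltnS leq_addr.
have mlt : (m < (n + m).+1)%N by rewrite ltnS leq_addl.
rewrite (bigD1 (Ordinal nlt)) //= (bigD1 (Ordinal mlt)) //= zv zw !eqxx.
rewrite big1 => [|j /negPf jm]; last first.
  by rewrite zw -[X in if X then _ else _]/(j == Ordinal mlt) jm (lin0 (Er w)) (lin0 (tl _)) scaler0.
rewrite addr0 big1 ?addr0 // => i /negPf ni; rewrite big1 // => j _.
by rewrite zv -[X in dg_mul (if X then _ else _) _]/(i == Ordinal nlt) ni (lin0 (Fl _)) (lin0 (tr _)) scaler0.
Qed.

Lemma pr_homog (G : dga k) n (x : G) : homog n (dg_pr n x).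
Proof. by rewrite /homog (dga_prK (dga_ax G)) eqxx. Qed.

Lemma hom_ext (W : lmodType k) (f g : tensor E F -> W) : linear f -> linear g ->
  (forall m n u v, homog m u -> homog n v -> f (tens u v) = g (tens u v)) -> f =1 g.
Proof.
move=> fL gL h; apply: linear_tensor_ext => // u v.
have [N ->] := dga_pr_sum axE u; have [M ->] := dga_pr_sum axF v.
rewrite (lin_sum (tl _)) (lin_sum fL) (lin_sum gL); apply: eq_bigr => i _.
rewrite (lin_sum (tr _)) (lin_sum fL) (lin_sum gL); apply: eq_bigr => j _.
exact: h (pr_homog _ _) (pr_homog _ _).
Qed.

Let T := tensor_dg E F.

Lemma signE m (u : E) : homog m u -> dg_sign u = (-1) ^+ m *: u.
Proof.
move=> hu; rewrite /dg_sign (@fsum_hom _ _ (fun n (x:E) => (-1) ^+ n *: x) m) //.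
by move=> n c x y; rewrite scalerDr !scalerA mulrC.
Qed.

Lemma sign_linear : linear (@dg_sign k E).
Proof.
apply: (@fsum_linear E _ (fun n (x:E) => (-1) ^+ n *: x)).
by move=> n c x y; rewrite scalerDr !scalerA mulrC.
Qed.

Let dL := dga_d_linear axE.
Let dLF := dga_d_linear axF.

Lemma d_bilin : bilin (fun (w : E) (v : F) => tens (dg_d w) v + tens (dg_sign w) (dg_d v)).
Proof.
split=> [v c u u'|w c v v'].
  by rewrite dL sign_linear !tl scalerDr addrACA.
by rewrite dLF !tr scalerDr addrACA.
Qed.

Lemma td_linear : linear (@dg_d k T).
Proof. exact: tlift_linear d_bilin. Qed.

Lemma tdE m (u : E) v : homog m u ->
  dg_d (tens u v : T) = tens (dg_d u) v + (-1) ^+ m *: tens u (dg_d v).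
Proof.
move=> hu; rewrite /= (tlift_tens _ _ d_bilin) (signE hu).
by rewrite (linZ (tl _)).
Qed.

Lemma tpr_linear n : linear (@dg_pr k T n).
Proof. by apply: linear_sumf => i; apply: tmap_linear. Qed.

Lemma tprE n a b (u : E) (v : F) : homog a u -> homog b v ->
  dg_pr n (tens u v : T) = if n == (a + b)%N then tens u v else 0.
Proof.
move=> hu hv.
have zu i : dg_pr i u = if i == a then u else 0.
  by rewrite -[in LHS]hu (dga_prK axE) hu.
have zv i : dg_pr i v = if i == b then v else 0.
  by rewrite -[in LHS]hv (dga_prK axF) hv.
transitivity (\sum_(i < n.+1) if (i == a :> nat) && (n == a + b)%N then tens u v else 0).
  apply: eq_bigr => i _; rewrite tmap_tens // zu zv.
  case: (eqVneq (i : nat) a) => [ia|_]; last by rewrite (lin0 (tl _)).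
  have -> : ((n - i)%N == b) = (n == a + b)%N.
    have := ltn_ord i; rewrite ltnS ia => le.
    by rewrite -{2}(subnKC le) eqn_add2l.
  by case: ifP => // _; rewrite (lin0 (tr _)).
case: eqP => [->|_]; last by rewrite big1 // => i _; rewrite andbF.
have lt : (a < (a + b).+1)%N by rewrite ltnS leq_addr.
rewrite (bigD1 (Ordinal lt)) //= eqxx /= big1 ?addr0 // => i /negPf ni.
by rewrite -[X in X && _]/(i == Ordinal lt) ni.
Qed.

Lemma homog_tens a b (u : E) (v : F) : homog a u -> homog b v -> homog (a + b)%N (tens u v : T).
Proof. by move=> hu hv; rewrite /homog (tprE _ hu hv) eqxx. Qed.

Lemma lin_comp (U V W : lmodType k) (f : V -> W) (g : U -> V) : linear f -> linear g -> linear (fun x => f (g x)).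
Proof. by move=> fL gL c x y; rewrite gL fL. Qed.
Lemma lin_add (U V : lmodType k) (f g : U -> V) : linear f -> linear g -> linear (fun x => f x + g x).
Proof. by move=> fL gL c x y; rewrite gL fL scalerDr addrACA. Qed.
Lemma lin_scale (U V : lmodType k) a (f : U -> V) : linear f -> linear (fun x => a *: f x).
Proof. by move=> fL c x y; rewrite fL scalerDr !scalerA mulrC. Qed.
Let Kl (y : T) : linear (fun x : T => dg_mul x y). Proof. exact: koszul_bilin.1. Qed.
Let Kr (y : T) : linear (fun x : T => dg_mul y x). Proof. exact: koszul_bilin.2. Qed.
Lemma tmE (w : E) (v : F) (w' : E) (v' : F) n m :
  homog n v -> homog m w' ->
  dg_mul (tens w v : T) (tens w' v' : T) =
  (-1) ^+ (n * m) *: (tens (dg_mul w w') (dg_mul v v') : T).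
Proof. exact: koszulE. Qed.
Let Kl0 y : dg_mul (0 : T) y = 0. Proof. exact: lin0 (Kl y). Qed.
Let Kr0 (y : T) : dg_mul y (0 : T) = 0. Proof. exact: lin0 (Kr y). Qed.
Let tpr0 n : dg_pr n (0 : T) = 0. Proof. exact: lin0 (tpr_linear n). Qed.
Let td0 : dg_d (0 : T) = 0. Proof. exact: lin0 (td_linear). Qed.

Lemma lin_id (U : lmodType k) : linear (fun x : U => x). Proof. by []. Qed.
Lemma lin_const0 (U V : lmodType k) : linear (fun x : U => 0 : V).
Proof. by move=> c x y; rewrite scaler0 addr0. Qed.

Lemma homogZ (G : dga k) n c (x : G) : homog n x -> homog n (c *: x).
Proof. by rewrite /homog (linZ (dga_pr_linear (dga_ax G) n)) => ->. Qed.

Local Ltac lintac := repeat first [exact: lin_id | exact: td_linear | exact: tpr_linear | exact: lin_const0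
  | exact: Kr | exact: Kl
  | apply: lin_add | apply: lin_scale | apply: (lin_comp (tpr_linear _)) | apply: (lin_comp td_linear)
  | apply: (lin_comp (Kr _)) | apply: (lin_comp (Kl _))].

Lemma tensor_dga_axioms : dga_axioms T.
Proof.
have HM := dga_homogM axE. have HMF := dga_homogM axF.
split.
- exact: koszul_bilin.
- move=> x y z; move: x; apply: hom_ext; [lintac|lintac|].
  move=> a b u v hu hv; move: y; apply: hom_ext; [lintac|lintac|].
  move=> a1 b1 u1 v1 hu1 hv1; move: z; apply: hom_ext; [lintac|lintac|].
  move=> a2 b2 u2 v2 hu2 hv2.
  rewrite (tmE _ _ hv1 hu2) (tmE _ _ hv hu1) (linZ (Kr _)) (linZ (Kl _)).
  rewrite (tmE _ _ hv (HM _ _ _ _ hu1 hu2)) (tmE _ _ (HMF _ _ _ _ hv hv1) hu2).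
  rewrite !scalerA -!exprD (dga_mulA axE) (dga_mulA axF); congr (_ ^+ _ *: _).
  rewrite mulnDl mulnDr. lia.
- move=> x; move: x; apply: hom_ext; [lintac|lintac|].
  move=> a b u v hu hv; rewrite (tmE _ _ (dga_homog1 axF) hu) mul0n scale1r.
  by rewrite (dga_mul1 axE) (dga_mul1 axF).
- move=> x; move: x; apply: hom_ext; [lintac|lintac|].
  move=> a b u v hu hv; rewrite (tmE _ _ hv (dga_homog1 axE)) muln0 scale1r.
  by rewrite (dga_mulr1 axE) (dga_mulr1 axF).
- exact: tpr_linear.
- move=> m n x.
  suff e : (fun x => dg_pr m (dg_pr n x : T)) =1 (fun x : T => if m == n then dg_pr n x else 0) by exact: e.
  apply: hom_ext; [lintac|case: (m == n); lintac|].
  move=> a b u v hu hv; rewrite (tprE n hu hv).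
  case: (n =P _) => [->|_]; last by rewrite if_same; exact: lin0 (tpr_linear m).
  by rewrite (tprE m hu hv).
- pose P (x : T) := exists N, forall M, (N <= M)%N -> x = \sum_(n < M) dg_pr n x.
  have PD x y : P x -> P y -> P (x + y).
    move=> [N hN] [M hM]; exists (N + M)%N => K le.
    under eq_bigr => i _ do rewrite (linD (tpr_linear _)).
    by rewrite big_split /= -hN -?hM // (leq_trans _ le) ?leq_addl ?leq_addr.
  have P0 : P 0.
    by exists 0%N => M _; rewrite big1 // => i _; rewrite tpr0.
  have PH a b (u : E) (v : F) : homog a u -> homog b v -> P (tens u v).
    move=> hu hv; exists (a + b).+1 => M le.
    rewrite (bigD1 (Ordinal le)) //= [X in _ = X + _](tprE _ hu hv) eqxx.
    rewrite big1 ?addr0 // => i /negPf ni; rewrite [LHS](tprE _ hu hv).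
    by rewrite -[X in if X then _ else _]/(i == Ordinal le) ni.
  move=> x; suff [N h] : P x by exists N; exact: h.
  rewrite (btensorE x); apply: big_ind => // -[u v] _ /=.
  have [N ->] := dga_pr_sum axE u; have [M ->] := dga_pr_sum axF v.
  rewrite -/(tens _ _) (lin_sum (tl _)); apply: big_ind => // i _.
  rewrite (lin_sum (tr _)); apply: big_ind => // j _.
  exact: PH (pr_homog _ _) (pr_homog _ _).
- by rewrite -[0%N]/(0 + 0)%N; apply: homog_tens; [apply: dga_homog1|apply: dga_homog1].
- move=> m n x y hx hy; rewrite -hx -hy.
  suff e : (fun x : T => dg_pr (m + n) (dg_mul (dg_pr m x) (dg_pr n y) : T)) =1
     (fun x : T => dg_mul (dg_pr m x) (dg_pr n y)) by exact: e.
  rewrite {hx} => {}x; move: y {hy} => y; move: x; apply: hom_ext; [lintac|lintac|].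
  move=> a b u v hu hv; move: y; apply: hom_ext; [lintac|lintac|].
  move=> a1 b1 u1 v1 hu1 hv1; rewrite (tprE _ hu hv) (tprE _ hu1 hv1).
  case: eqP => [->|_]; last by rewrite Kl0 tpr0.
  case: eqP => [->|_]; last by rewrite Kr0 tpr0.
  rewrite (tmE _ _ hv hu1) (linZ (tpr_linear _)).
  by rewrite (tprE _ (HM _ _ _ _ hu hu1) (HMF _ _ _ _ hv hv1)) addnACA eqxx.
- exact: td_linear.
- move=> n x hx; rewrite -hx.
  suff e : (fun x : T => dg_pr n.+1 (dg_d (dg_pr n x) : T)) =1 (fun x : T => dg_d (dg_pr n x)) by exact: e.
  apply: hom_ext; [lintac|lintac|].
  move=> a b u v hu hv; rewrite (tprE _ hu hv).
  case: eqP => [->|_]; last by rewrite !td0 tpr0.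
  rewrite (tdE _ hu) (linD (tpr_linear _)) (linZ (tpr_linear _)).
  rewrite (tprE _ (dga_homog_d axE hu) hv) (tprE _ hu (dga_homog_d axF hv)).
  by rewrite addSn addnS eqxx.
- move=> x.
  suff e : (fun x : T => dg_d (dg_d x)) =1 (fun _ => 0) by exact: e.
  apply: hom_ext; [lintac|lintac|].
  move=> a b u v hu hv; rewrite (tdE _ hu) (linD td_linear) (linZ td_linear).
  rewrite (tdE _ hu) (tdE _ (dga_homog_d axE hu)) (dga_dd axE) (dga_dd axF).
  rewrite (lin0 (tl _)) (lin0 (tr _)) scaler0 addr0 add0r exprS mulN1r scaleNr.
  exact: addNr.
- move=> n x y hx; rewrite -hx.
  suff e : (fun x : T => dg_d (dg_mul (dg_pr n x) y : T)) =1 (fun x : T =>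
     dg_mul (dg_d (dg_pr n x)) y + (-1) ^+ n *: dg_mul (dg_pr n x) (dg_d y)) by exact: e.
  rewrite {hx} => {}x; move: x; apply: hom_ext; [lintac|lintac|].
  move=> a b u v hu hv; rewrite (tprE _ hu hv).
  case: eqP => [->|_]; last first.
    by rewrite !Kl0 !td0 Kl0 scaler0 addr0.
  move: y; apply: hom_ext; [lintac|lintac|].
  move=> a1 b1 u1 v1 hu1 hv1.
  rewrite (tdE _ hu1) (tdE _ hu) (tmE _ _ hv hu1) (linZ td_linear).
  rewrite (tdE _ (HM _ _ _ _ hu hu1)) (linD (Kl _)) (linD (Kr _)) (linZ (Kl _)) (linZ (Kr _)).
  rewrite (tmE _ _ hv hu1) (tmE _ _ (dga_homog_d axF hv) hu1).
  rewrite (tmE _ _ hv (dga_homog_d axE hu1)) (tmE _ _ hv hu1).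
  rewrite (dga_leibniz axE _ hu) (dga_leibniz axF _ hv).
  rewrite !(linD (tl _)) !(linD (tr _)) !(linZ (tl _)) !(linZ (tr _)).
  rewrite !scalerDr !scalerA -!exprD -!addrA; congr (_ + _).
  rewrite [RHS]addrCA; congr (_ + (_ + _)); congr (_ *: _).
  + rewrite -[LHS]signr_odd -[RHS]signr_odd; congr (_ ^+ nat_of_bool _); lia.
  + by rewrite mulSn; congr (_ ^+ _); lia.
  + by congr (_ ^+ _); lia.
Qed.
End TensorDGA.

(** * Differential calculi *)

Section Calculus.
Variables (k : fieldType) (A : algType k).

(** a0 da1 ... dan *)
Definition form_word (E : dgdata k) (i : A -> E) (a0 : A) (s : seq A) : E :=
  dg_mul (i a0) (foldr (fun a w => dg_mul (dg_d (i a)) w) dg_one s).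

Record calculus_axioms (E : dgdata k) (i : A -> E) : Prop := CalculusAxioms {
  cal_linear : linear i;
  cal_one : i 1 = dg_one;
  cal_mul : forall a b, i (a * b) = dg_mul (i a) (i b);
  cal_inj : injective i;
  cal_deg0 : forall x, homog 0 x <-> exists a, x = i a;
  cal_span : forall n (x : E), homog n x ->
    exists s : seq (A * n.-tuple A), x = \sum_(p <- s) form_word i p.1 p.2
}.

Record calculus := Calculus {
  cal_dga :> dga k;
  cal_in : A -> cal_dga;
  cal_ax : calculus_axioms cal_in
}.

End Calculus.

(** * Bicovariant calculi on a Hopf algebra *)

Section FirstOrder.
Variables (k : fieldType) (H : hopfAlgebra k).

Record fodc := Fodc {
  fo_mod :> lmodType k;
  fo_l : H -> fo_mod -> fo_mod;
  fo_r : fo_mod -> H -> fo_mod;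
  fo_d : H -> fo_mod;
  fo_l_bilin : bilin fo_l;
  fo_lA : forall g h w, fo_l g (fo_l h w) = fo_l (g * h) w;
  fo_l1 : forall w, fo_l 1 w = w;
  fo_r_bilin : bilin fo_r;
  fo_rA : forall w g h, fo_r (fo_r w g) h = fo_r w (g * h);
  fo_r1 : forall w, fo_r w 1 = w;
  fo_lr : forall g w h, fo_r (fo_l g w) h = fo_l g (fo_r w h);
  fo_d_linear : linear fo_d;
  fo_leibniz : forall g h, fo_d (g * h) = fo_r (fo_d g) h + fo_l g (fo_d h);
  fo_span : forall w, exists s : seq (H * H),
    w = \sum_(p <- s) fo_l p.1 (fo_d p.2)
}.

(** G is an H-bicomodule, its coactions are compatible with the bimodule
    structure, and d is bicolinear. *)
Definition bicovariant (G : fodc) : Prop :=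
  exists (lam : G -> tensor H G) (rho : G -> tensor G H),
  [/\ [/\ left_coaction lam, right_coaction rho
        & forall w, tassoc (tmap lam id (rho w)) = tmap id rho (lam w)],
      forall h w, lam (fo_l h w) = tmap2 *%R (@fo_l G) (hopf_Delta h) (lam w) /\
                  lam (fo_r w h) = tmap2 *%R (@fo_r G) (lam w) (hopf_Delta h),
      forall h w, rho (fo_l h w) = tmap2 (@fo_l G) *%R (hopf_Delta h) (rho w) /\
                  rho (fo_r w h) = tmap2 (@fo_r G) *%R (rho w) (hopf_Delta h)
    & forall h, lam (fo_d G h) = tmap id (fo_d G) (hopf_Delta h) /\
                rho (fo_d G h) = tmap (fo_d G) id (hopf_Delta h)].

Record zact := ZAct { za_car :> zmodType; za_act : H -> za_car -> za_car }.

(** The tensor powers G (x)_H ... (x)_H G, with their left H-action; the zeroth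
    one is H. *)
Fixpoint tpow (G : fodc) (n : nat) : zact :=
  if n is n'.+1 then
    @ZAct (btensor (@fo_r G) (@za_act (tpow G n')))
          (fun h => blift (fun w t => btens _ _ (fo_l h w) t))
  else @ZAct H (fun h g => h * g).

Definition tpow_cons (G : fodc) n (w : G) (t : tpow G n) : tpow G n.+1 :=
  btens _ _ w t.

(** The ideal of the tensor algebra of G over H generated by the elements
    sum_i da_i (x) db_i for which sum_i a_i db_i = 0, degree by degree. *)
Inductive prolong_ideal (G : fodc) : forall n, tpow G n -> Prop :=
| PI_gen (s : seq (H * H)) n (t : tpow G n) :
    \sum_(p <- s) fo_l p.1 (fo_d G p.2) = 0 ->
    prolong_ideal
      (\sum_(p <- s) tpow_cons (fo_d G p.1) (tpow_cons (fo_d G p.2) t))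
| PI_cons n (w : G) (t : tpow G n) : prolong_ideal t -> prolong_ideal (tpow_cons w t)
| PI_zero n : prolong_ideal (0 : tpow G n)
| PI_add n (t u : tpow G n) :
    prolong_ideal t -> prolong_ideal u -> prolong_ideal (t + u)
| PI_act n h (t : tpow G n) : prolong_ideal t -> prolong_ideal (za_act h t).

(** The map of tensor powers into an algebra containing H and G. *)
Fixpoint tpow_map (G : fodc) (E : dgdata k) (i : H -> E) (j : G -> E) (n : nat) :
    tpow G n -> E :=
  if n is n'.+1 return tpow G n -> E then
    blift (fun w t => dg_mul (j w) (tpow_map i j t))
  else i.

(** The canonical map T_H(G) -> E, built from i : H -> E and j : G -> E, is
    well defined, surjective in each degree, and has the ideal above as kernel;
    so E is a copy of the quotient, with d extending that of G. *)
Record maximal_prolongation (G : fodc) (E : dgdata k) (i : H -> E) (j : G -> E) :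
    Prop := MaximalProlongation {
  mp_cal : calculus_axioms i;
  mp_linear : linear j;
  mp_l : forall h w, j (fo_l h w) = dg_mul (i h) (j w);
  mp_r : forall w h, j (fo_r w h) = dg_mul (j w) (i h);
  mp_d : forall h, dg_d (i h) = j (fo_d G h);
  mp_surj : forall n x, homog n x <-> exists t : tpow G n, x = tpow_map i j t;
  mp_ker : forall n (t : tpow G n), tpow_map i j t = 0 <-> prolong_ideal t
}.

(** A bicovariant first order calculus with its maximal prolongation, such that
    the coproduct extends to a morphism of differential graded algebras. *)
Record hopfCalculus := HopfCalculus {
  hc_fo : fodc;
  hc_bicov : bicovariant hc_fo;
  hc_dga :> dga k;
  hc_in : H -> hc_dga;
  hc_in1 : hc_fo -> hc_dga;
  hc_max : maximal_prolongation hc_in hc_in1;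
  hc_Delta : hc_dga -> tensor_dg hc_dga hc_dga;
  hc_Delta_morph : dg_morphism hc_Delta;
  hc_Delta_in : forall h, hc_Delta (hc_in h) = tmap hc_in hc_in (hopf_Delta h)
}.

End FirstOrder.

Arguments tpow_map {k H G E} i j {n} t.

Section Vertical.
Variables (k : fieldType) (H : hopfAlgebra k) (O : hopfCalculus H).

(** The left coaction of H on forms is the component of [hc_Delta] whose first
    leg has degree 0, Omega^0(H) being H. *)
Definition lcoinv : {pred O} := fun w =>
  `[< tmap (dg_pr 0) id (hc_Delta w : tensor O O) = tens dg_one w >].

Lemma lcoinvP (w : O) :
  reflect (tmap (dg_pr 0) id (hc_Delta w : tensor O O) = tens dg_one w)
          (w \in lcoinv).
Proof. exact: asboolP. Qed.

Fact lcoinv_submod : submod_closed lcoinv.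
Proof.
have DL := dgm_linear (hc_Delta_morph O).
have [tl tr] := tens_bilin O O.
have pL : linear (tmap (@dg_pr k O 0) (@id O)).
  by apply: tmap_linear => //; exact: (dga_pr_linear (dga_ax O)).
split=> [|c u v /lcoinvP hu /lcoinvP hv]; apply/lcoinvP.
  have := DL (-1) 0 0; rewrite !scaleN1r !addNr => ->.
  have := pL (-1) 0 0; rewrite !scaleN1r !addNr => ->.
  by have := tr dg_one (-1) 0 0; rewrite !scaleN1r !addNr.
by rewrite DL pL hu hv tr.
Qed.
HB.instance Definition _ := GRing.isSubmodClosed.Build k O lcoinv lcoinv_submod.

Record coinv_forms := CoinvForms { coinv_forms_val :> O; _ : coinv_forms_val \in lcoinv }.
HB.instance Definition _ := [isSub for coinv_forms_val].
HB.instance Definition _ := [Choice of coinv_forms by <:].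
HB.instance Definition _ := [SubChoice_isSubLmodule of coinv_forms by <:].

(** th <- h = S(h_1) th h_2 *)
Definition form_ract (th : O) (h : H) : O :=
  tlift (fun x y => dg_mul (dg_mul (hc_in O (hopf_S x)) th) (hc_in O y))
        (hopf_Delta h).

Definition pi_eps (h : H) : H := h - (hopf_eps h)%:A.

Definition varpi (h : H) : O :=
  tlift (fun x y => dg_mul (hc_in O (hopf_S x)) (dg_d (hc_in O y)))
        (hopf_Delta h).

(** Corestriction to coinvariant forms, with a junk value elsewhere; it is only
    applied to forms that are coinvariant. *)
Definition to_coinv (w : O) : coinv_forms := insubd 0 w.

Variable A : comodAlgebra H.

(** A (x) Lambda with
    (a (x) th) (b (x) et) = a b_0 (x) (th <- b_1) et and
    d (a (x) th) = a (x) d th + a_0 (x) varpi (pi_eps a_1) th. *)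
Definition ver_dg : dgdata k := {|
  dg_car := tensor A coinv_forms;
  dg_mul := fun x y =>
    tlift (fun a (th : coinv_forms) => tlift (fun b (et : coinv_forms) =>
      tlift (fun b0 b1 =>
          tens (a * b0) (to_coinv (dg_mul (form_ract (val th) b1) (val et))))
        (ca_coact b)) y) x;
  dg_one := tens 1 (to_coinv dg_one);
  dg_d := tlift (fun a (th : coinv_forms) =>
    tens a (to_coinv (dg_d (val th))) +
    tlift (fun a0 a1 => tens a0 (to_coinv (dg_mul (varpi (pi_eps a1)) (val th))))
      (ca_coact a));
  dg_pr := fun n => tmap id (fun th : coinv_forms => to_coinv (dg_pr n (val th)))
|}.

Definition ver_in (a : A) : ver_dg := tens a (to_coinv dg_one).

(** [D] is an extension of the coaction of A to a morphism of differential
    graded algebras E -> E (x) Omega(H). *)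
Definition coaction_extension (E : dgdata k) (i : A -> E)
    (D : E -> tensor_dg E O) : Prop :=
  dg_morphism D /\ forall a, D (i a) = tmap i (hc_in O) (ca_coact a).

Definition complete (E : dgdata k) (i : A -> E) : Prop :=
  exists D, @coaction_extension E i D.

(** Omega(A) being generated by A and dA, such a map is unique: it sends
    a^0 da^1 ... da^n to
    a^0_0 ... a^n_0 (x) S(a^0_1 ... a^n_1) a^0_2 da^1_2 ... da^n_2. *)
Definition is_pi_ver (OA : calculus A) (p : OA -> ver_dg) : Prop :=
  [/\ dg_morphism p, forall v, exists w, p w = v
    & forall a, p (cal_in OA a) = ver_in a].

End Vertical.

Arguments complete {k H} O {A E} i.
Arguments coaction_extension {k H} O {A E} i D.
Arguments is_pi_ver {k H} O {A} OA p.

(* Main.v *)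
Require Import Defs.
From mathcomp Require Import all_boot all_algebra.
From mathcomp Require Import boolp zify.

Set Implicit Arguments.
Unset Strict Implicit.
Unset Printing Implicit Defensive.

Import GRing.Theory.
Local Open Scope ring_scope.

(** Why the statement holds.  Write i : H -> Omega(H) for the inclusion of
    degree 0, w_1 (x) w_2 for the extended coproduct of a form w, and
    lambda(w) = w_{-1} (x) w_0 for the left coaction of H on forms, obtained
    from the coproduct by projecting its first leg to degree 0.

    The algebra A, put in degree 0 with zero differential, is itself a
    differential graded algebra, so A (x) Omega(H) is one as well, and there the
    product has no signs.  Vertical forms embed into it by
    J : a (x) th |-> a_0 (x) a_1 th  ([ver_emb]; the image is the cotensor
    product of A and Omega(H) over H).  Under J the twisted product and the
    twisted differential of vertical forms become the plain ones
    ([ver_emb_dg_morphism]), and J is split by id (x) P, where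
    P(w) = S(w_{-1}) w_0 is the projection of forms onto coinvariant forms
    ([ver_embK]).  In particular vertical forms satisfy the axioms of a
    differential graded algebra because A (x) Omega(H) does.

    Since id (x) Delta is a morphism on A (x) Omega(H), the candidate
    a (x) th |-> (a_0 (x) th_1) (x) a_1 th_2 for the coaction on vertical forms
    is a morphism as soon as it satisfies
    (J (x) id) o coaction = (id (x) Delta) o J, because J (x) id is an injective
    morphism.  The point is that (id (x) Delta) o J takes its values in the
    image of J (x) id ([ver_emb_coact]).  That image is closed under products
    and a (x) th = (a (x) 1)(1 (x) th), so this is needed only for a (x) 1,
    where it is the coassociativity of the coaction of A, and for 1 (x) th,
    where it says that the first leg of Delta(th) is coinvariant
    ([hc_Delta_coinv]).

    The compatibility with pi_ver is then formal: both sides are morphisms on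
    Omega(A) with the same restriction to A, and a morphism on a differential
    calculus is determined by its restriction to degree 0
    ([calculus_morphism_ext]).  The same principle gives the coassociativity and
    counit laws of lambda from those of H.

    All Sweedler computations are equalities of linear maps on tensor products,
    proved on pure tensors; the tactic [lin] supplies the linearity they need. *)

(** * Linearity and tensor products *)

Section LinearFamilies.
Variable k : fieldType.
Implicit Types U V W Z : lmodType k.

Lemma bilin_intro U V W (f : U -> V -> W) :
  (forall v, linear (fun u => f u v)) -> (forall u, linear (f u)) -> bilin f.
Proof. by []. Qed.

Lemma tens_linear_l U V (v : V) : linear (fun u : U => tens u v).
Proof. exact: (tens_bilin U V).1. Qed.

Lemma tens_linear_r U V (u : U) : linear (@tens k U V u).
Proof. exact: (tens_bilin U V).2. Qed.

Lemma eq_tlift U V (W : zmodType) (f g : U -> V -> W) x :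
  (forall u v, f u v = g u v) -> tlift f x = tlift g x.
Proof. by move=> e; apply: eq_bigr => p _; exact: e. Qed.

Lemma tlift_param_linear U V W Z (F : Z -> U -> V -> W) x :
  (forall z, bilin (F z)) -> (forall u v, linear (fun z => F z u v)) ->
  linear (fun z => tlift (F z) x).
Proof.
move=> bF lF c y z; move: x; apply: linear_tensor_ext => [||u v].
- exact: tlift_linear.
- by apply: lin_add; [apply: lin_scale|]; apply: tlift_linear.
- by rewrite !tlift_tens // lF.
Qed.

Lemma tmap_param_linear_l U V U' V' Z (F : Z -> U -> U') (g : V -> V') x :
  (forall z, linear (F z)) -> (forall u, linear (fun z => F z u)) -> linear g ->
  linear (fun z => tmap (F z) g x).
Proof.
move=> lF lF' gL; apply: (tlift_param_linear (F := fun z u v => tens (F z u) (g v))).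
  by move=> z; exact: tmap_bilin.
by move=> u v; exact: lin_comp (tens_linear_l _) (lF' u).
Qed.

Lemma tmap_param_linear_r U V U' V' Z (f : U -> U') (G : Z -> V -> V') x :
  (forall z, linear (G z)) -> (forall v, linear (fun z => G z v)) -> linear f ->
  linear (fun z => tmap f (G z) x).
Proof.
move=> lG lG' fL; apply: (tlift_param_linear (F := fun z u v => tens (f u) (G z v))).
  by move=> z; exact: tmap_bilin.
by move=> u v; exact: lin_comp (tens_linear_r _) (lG' v).
Qed.

End LinearFamilies.

(** The equation [eG] lets the structure [G] be inferred from the data [E], by
    unification with the canonical instances below. *)
Section DgaLinear.
Variables (k : fieldType) (E : dgdata k).
Variables (G : dga k) (eG : dga_data G = E).

Lemma dg_mul_linear_l (y : E) : linear (fun x => dg_mul x y).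
Proof. by case: _ / eG y => y; exact: (dga_mul_bilin (dga_ax G)).1. Qed.

Lemma dg_mul_linear_r (x : E) : linear (dg_mul x).
Proof. by case: _ / eG x => x; exact: (dga_mul_bilin (dga_ax G)).2. Qed.

Lemma dg_pr_linear n : linear (@dg_pr k E n).
Proof. by case: _ / eG; exact: (dga_pr_linear (dga_ax G)). Qed.

Lemma dg_d_linear : linear (@dg_d k E).
Proof. by case: _ / eG; exact: (dga_d_linear (dga_ax G)). Qed.

End DgaLinear.

Lemma mul_linear_l (k : fieldType) (A : algType k) (b : A) : linear (fun a => a * b).
Proof. by move=> c x y; rewrite mulrDl scalerAl. Qed.

Lemma mul_linear_r (k : fieldType) (A : algType k) (a : A) : linear (fun b => a * b).
Proof. by move=> c x y; rewrite mulrDr scalerAr. Qed.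

Lemma scale_linear_r (k : fieldType) (V : lmodType k) (a : k) : linear (fun v : V => a *: v).
Proof. by move=> c x y; rewrite scalerDr !scalerA mulrC. Qed.

(** Extension point of [lin]: the linear maps known by name. *)
Ltac lin_atom := fail.

(** Proves [linear f] and [bilin f] by following the syntax of [f]; what it
    cannot decompose is left as a goal. *)
Ltac lin :=
  lazymatch goal with
  | |- bilin _ => apply: bilin_intro => ?; lin
  | |- forall _, bilin _ => intro; lin
  | |- forall _, linear _ => intro; lin
  | |- forall _ _, linear _ => do 2 intro; lin
  | |- linear _ => cbv beta;
    first
    [ assumption
    | exact: lin_id
    | lin_atom
    | exact: tens_linear_r | exact: tens_linear_l
    | lazymatch goal with
      | |- linear (fun x => @dg_mul ?k ?E x ?y) => refine (@dg_mul_linear_l k E _ erefl y)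
      | |- linear (@dg_mul ?k ?E ?x) => refine (@dg_mul_linear_r k E _ erefl x)
      | |- linear (@dg_pr ?k ?E ?n) => refine (@dg_pr_linear k E _ erefl n)
      | |- linear (@dg_d ?k ?E) => refine (@dg_d_linear k E _ erefl)
      end
    | exact: mul_linear_r | exact: mul_linear_l
    | exact: scale_linear_r
    | match goal with
      | h : bilin ?F |- linear (?F _) => exact: h.2
      | h : bilin ?F |- linear (fun x => ?F x _) => exact: h.1
      | h : forall z, linear _ |- _ => exact: h
      | h : forall z, bilin _ |- linear _ => solve [exact: (h _).1 | exact: (h _).2]
      end
    | lazymatch goal with
      | |- linear (tmap _ _) => apply: tmap_linear
      | |- linear (tlift _) => apply: tlift_linear
      end; lin
    (* Here h may capture x; then the application fails and the cases below,
       where x occurs in an earlier argument, take over. *)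
    | match goal with |- linear (fun x => ?h (@?f x)) =>
        apply: (@lin_comp _ _ _ _ h f) end; lin
    | match goal with
      | |- linear (fun x => @?f x + @?g x) => apply: (@lin_add _ _ _ f g)
      | |- linear (fun x => tlift (@?F x) ?y) =>
          apply: (@tlift_param_linear _ _ _ _ _ F y)
      | |- linear (fun x => tmap (@?F x) ?g ?y) =>
          apply: (@tmap_param_linear_l _ _ _ _ _ _ F g y)
      | |- linear (fun x => tmap ?f (@?G x) ?y) =>
          apply: (@tmap_param_linear_r _ _ _ _ _ _ f G y)
      end; lin
    | lazymatch goal with
      | |- linear (fun x => ?h x ?v) => fail
      | |- linear (fun x => ?h (@?f x) ?v) =>
          apply: (@lin_comp _ _ _ _ (fun u => h u v) f)
      end; lin
    | idtac ]
  | |- _ => idtac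
  end.

Section TensorCalculus.
Variable k : fieldType.
Implicit Types U V W Z : lmodType k.

Lemma eq_tmap U V U' V' (f f' : U -> U') (g g' : V -> V') x :
  f =1 f' -> g =1 g' -> tmap f g x = tmap f' g' x.
Proof. by move=> ef eg; apply: eq_tlift => u v; rewrite ef eg. Qed.

Lemma tmap_id U V (x : tensor U V) : tmap id id x = x.
Proof.
move: x; apply: linear_tensor_ext => [||u v]; [lin|lin|].
by rewrite tmap_tens.
Qed.

Lemma tmap_comp U V U' V' U'' V'' (f' : U' -> U'') (g' : V' -> V'')
    (f : U -> U') (g : V -> V') x :
  linear f' -> linear g' -> linear f -> linear g ->
  tmap f' g' (tmap f g x) = tmap (fun u => f' (f u)) (fun v => g' (g v)) x.
Proof.
move=> f'L g'L fL gL; move: x; apply: linear_tensor_ext => [||u v]; [lin|lin|].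
by rewrite !tmap_tens //; lin.
Qed.

Lemma tlift_tmap U V U' V' W (F : U' -> V' -> W) (f : U -> U') (g : V -> V') x :
  bilin F -> linear f -> linear g ->
  tlift F (tmap f g x) = tlift (fun u v => F (f u) (g v)) x.
Proof.
move=> bF fL gL; have [Fl Fr] := bF.
have bFg : bilin (fun u v => F (f u) (g v)) by lin.
move: x; apply: linear_tensor_ext => [||u v]; [lin|lin|].
by rewrite tmap_tens // !tlift_tens.
Qed.

Lemma lin_tlift U V W W' (f : W -> W') (F : U -> V -> W) x : linear f -> bilin F ->
  f (tlift F x) = tlift (fun u v => f (F u v)) x.
Proof.
move=> fL bF; have [Fl Fr] := bF.
have bfF : bilin (fun u v => f (F u v)) by lin.
move: x; apply: linear_tensor_ext => [||u v]; [lin|lin|].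
by rewrite !tlift_tens.
Qed.

Lemma tassoc_linear U V W : linear (@tassoc k U V W).
Proof. rewrite /tassoc; lin. Qed.

Ltac lin_atom ::= exact: tassoc_linear.

Lemma tassoc_tens U V W (u : U) (v : V) (w : W) :
  tassoc (tens (tens u v) w) = tens u (tens v w).
Proof. by rewrite /tassoc !tlift_tens //; lin. Qed.

Lemma linear_tensor_ext_l U V W Z (f g : tensor (tensor U V) W -> Z) :
  linear f -> linear g ->
  (forall u v w, f (tens (tens u v) w) = g (tens (tens u v) w)) -> f =1 g.
Proof.
move=> fL gL e; apply: linear_tensor_ext => // x w; move: x.
by apply: (linear_tensor_ext (f := fun x => f (tens x w)) (g := fun x => g (tens x w)));
  [lin|lin|].
Qed.

Lemma tassoc_tmap U V W U' V' W' (f : U -> U') (g : V -> V') (h : W -> W') x :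
  linear f -> linear g -> linear h ->
  tassoc (tmap (tmap f g) h x) = tmap f (tmap g h) (tassoc x).
Proof.
move=> fL gL hL; move: x.
apply: linear_tensor_ext_l => [||u v w]; [lin|lin|].
by rewrite tassoc_tens !tmap_tens ?tassoc_tens //; lin.
Qed.

End TensorCalculus.

(** * Morphisms of differential graded algebras *)

Canonical tensor_dga (k : fieldType) (E F : dga k) : dga k :=
  DGA (tensor_dga_axioms E F).

Section Morphisms.
Variable k : fieldType.

Lemma dg_morphism_comp (E F G : dgdata k) (g : F -> G) (f : E -> F) :
  dg_morphism g -> dg_morphism f -> dg_morphism (fun x => g (f x)).
Proof.
move=> gM fM; split.
- exact: lin_comp (dgm_linear gM) (dgm_linear fM).
- by rewrite (dgm_one fM) (dgm_one gM).
- by move=> x y; rewrite (dgm_mul fM) (dgm_mul gM).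
- by move=> x; rewrite (dgm_d fM) (dgm_d gM).
- by move=> n x; rewrite (dgm_pr fM) (dgm_pr gM).
Qed.

Lemma dg_morphism_id (E : dgdata k) : dg_morphism (@id E).
Proof. by split. Qed.

Lemma dg_morphism_homog (E F : dgdata k) (f : E -> F) n x :
  dg_morphism f -> homog n x -> homog n (f x).
Proof. by move=> fM hx; rewrite /homog -(dgm_pr fM) hx. Qed.

(** Being a morphism can be tested after an injective morphism. *)
Lemma dg_morphism_cancel (E F G : dgdata k) (j : F -> G) (l : G -> F) (f : E -> F) :
  cancel j l -> dg_morphism j -> dg_morphism (fun x => j (f x)) -> dg_morphism f.
Proof.
move=> /can_inj ji jM fM; split.
- by move=> c x y; apply: ji; rewrite (dgm_linear fM) (dgm_linear jM).
- by apply: ji; rewrite (dgm_one fM) (dgm_one jM).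
- by move=> x y; apply: ji; rewrite (dgm_mul fM) (dgm_mul jM).
- by move=> x; apply: ji; rewrite (dgm_d fM) (dgm_d jM).
- by move=> n x; apply: ji; rewrite (dgm_pr fM) (dgm_pr jM).
Qed.

(** Every axiom is an identity between expressions in the operations, possibly
    for homogeneous arguments, except the finiteness of the decomposition of x,
    where the bound for j(x) serves for x.  So subobjects inherit them all. *)
Lemma dga_axioms_inj (E : dgdata k) (T : dga k) (j : E -> T) :
  injective j -> dg_morphism j -> dga_axioms E.
Proof.
move=> ji jM; have jL := dgm_linear jM; have ax := dga_ax T.
have jM1 := dgm_one jM; have jMM := dgm_mul jM.
have jMd := dgm_d jM; have jMp := dgm_pr jM.
have jH n x : homog n x -> homog n (j x) by exact: dg_morphism_homog.
have Hj n x : homog n (j x) -> homog n x by move=> h; apply: ji; rewrite jMp.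
split.
- split=> [z c x y|z c x y]; apply: ji; rewrite jL !jMM jL.
    by rewrite (dga_mul_bilin ax).1.
  by rewrite (dga_mul_bilin ax).2.
- by move=> x y z; apply: ji; rewrite !jMM (dga_mulA ax).
- by move=> x; apply: ji; rewrite jMM jM1 (dga_mul1 ax).
- by move=> x; apply: ji; rewrite jMM jM1 (dga_mulr1 ax).
- by move=> n c x y; apply: ji; rewrite jMp !jL !jMp (dga_pr_linear ax).
- move=> m n x; apply: ji; rewrite !jMp (dga_prK ax).
  by case: ifP => _; rewrite ?jMp ?(lin0 jL).
- move=> x; have [N e] := dga_pr_sum ax (j x); exists N; apply: ji.
  by rewrite (lin_sum jL) e; apply: eq_bigr => i _; rewrite jMp.
- by apply: Hj; rewrite jM1; exact: dga_homog1 ax.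
- by move=> m n x y hx hy; apply: Hj; rewrite jMM; apply: (dga_homogM ax); apply: jH.
- by move=> c x y; apply: ji; rewrite jMd !jL !jMd (dga_d_linear ax).
- by move=> n x hx; apply: Hj; rewrite jMd; apply: (dga_homog_d ax); apply: jH.
- by move=> x; apply: ji; rewrite !jMd (dga_dd ax) (lin0 jL).
- move=> n x y hx; apply: ji; rewrite jMd jMM (dga_leibniz ax _ (jH _ _ hx)).
  by rewrite (linD jL) (linZ jL) !jMM !jMd.
Qed.

(** The Leibniz rule for 1 * 1 gives d 1 = d 1 + d 1. *)
Lemma dga_d1 (E : dga k) : dg_d (dg_one : E) = 0.
Proof.
have ax := dga_ax E; have := dga_leibniz ax dg_one (dga_homog1 ax).
rewrite (dga_mul1 ax) (dga_mulr1 ax) scale1r => /eqP.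
by rewrite (dga_mul1 ax) -subr_eq subrr eq_sym => /eqP.
Qed.

Lemma pr_mul0 (E : dga k) n (x y : E) :
  homog 0 x -> dg_pr n (dg_mul x y) = dg_mul x (dg_pr n y).
Proof.
move=> hx; have ax := dga_ax E; have [N ->] := dga_pr_sum ax y.
have L m := dga_pr_linear ax m; have R := dg_mul_linear_r erefl x.
rewrite (lin_sum R) !(lin_sum (L _)) (lin_sum R); apply: eq_bigr => i _.
have h : homog i (dg_mul x (dg_pr i y)).
  by apply: (dga_homogM ax hx); exact: pr_homog.
rewrite -h !(dga_prK ax); case: ifP => // _; by rewrite (lin0 R).
Qed.

Section Calculus.
Variables (A : algType k) (E : dga k) (i : A -> E).
Hypothesis cal : calculus_axioms i.

Lemma cal_homog a : homog 0 (i a).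
Proof. by apply/(cal_deg0 cal); exists a. Qed.

(** A calculus is spanned by words in A and d A, and a morphism is determined on
    such a word by its values on A. *)
Lemma calculus_morphism_ext (F : dgdata k) (f g : E -> F) :
  dg_morphism f -> dg_morphism g -> (forall a, f (i a) = g (i a)) -> f =1 g.
Proof.
move=> fM gM e x; have [N ->] := dga_pr_sum (dga_ax E) x.
rewrite (lin_sum (dgm_linear fM)) (lin_sum (dgm_linear gM)).
apply: eq_bigr => n _; have [s ->] := cal_span cal (pr_homog n x).
rewrite (lin_sum (dgm_linear fM)) (lin_sum (dgm_linear gM)).
apply: eq_bigr => -[a0 t] _; rewrite /form_word (dgm_mul fM) (dgm_mul gM) e.
congr dg_mul; elim: {t}(val t) => /= [|a t IH].
  by rewrite (dgm_one fM) (dgm_one gM).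
by rewrite (dgm_mul fM) (dgm_mul gM) IH (dgm_d fM) (dgm_d gM) e.
Qed.

End Calculus.

Lemma tmap_dg_morphism (E F E' F' : dga k) (f : E -> E') (g : F -> F') :
  dg_morphism f -> dg_morphism g ->
  dg_morphism (tmap f g : tensor_dg E F -> tensor_dg E' F').
Proof.
move=> fM gM; have fL := dgm_linear fM; have gL := dgm_linear gM.
have fH n x : homog n x -> homog n (f x) by exact: dg_morphism_homog.
have gH n x : homog n x -> homog n (g x) by exact: dg_morphism_homog.
have mL : linear (tmap f g : tensor_dg E F -> tensor_dg E' F').
  exact: tmap_linear.
split=> //.
- by rewrite /= tmap_tens // (dgm_one fM) (dgm_one gM).
- move=> x y; move: x; apply: hom_ext; [lin|lin|].
  move=> a b u v hu hv; move: y; apply: hom_ext; [lin|lin|].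
  move=> a' b' u' v' hu' hv'.
  rewrite !tmap_tens // (tmE _ _ hv hu') (tmE _ _ (gH _ _ hv) (fH _ _ hu')).
  by rewrite (linZ mL) tmap_tens // (dgm_mul fM) (dgm_mul gM).
- apply: hom_ext; [lin|lin|] => a b u v hu hv.
  rewrite tmap_tens // (tdE _ hu) (tdE _ (fH _ _ hu)) (linD mL) (linZ mL).
  by rewrite !tmap_tens // (dgm_d fM) (dgm_d gM).
- move=> n; apply: hom_ext; [lin|lin|] => a b u v hu hv.
  rewrite tmap_tens // (tprE _ hu hv) (tprE _ (fH _ _ hu) (gH _ _ hv)).
  by case: ifP => _; rewrite ?tmap_tens // (lin0 mL).
Qed.

Lemma tassoc_dg_morphism (E F G : dga k) :
  dg_morphism (@tassoc k E F G :
    tensor_dg (tensor_dg E F) G -> tensor_dg E (tensor_dg F G)).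
Proof.
set al := (X in dg_morphism X).
have aL : linear al by exact: tassoc_linear.
have ext (V : lmodType k) (f g : tensor_dg (tensor_dg E F) G -> V) :
    linear f -> linear g -> (forall a b c u v w, homog a u -> homog b v -> homog c w ->
      f (tens (tens u v) w) = g (tens (tens u v) w)) -> f =1 g.
  move=> fL gL e; apply: hom_ext => // a c x w hx hw; rewrite -hx; move: x {hx}.
  apply: (@hom_ext k E F V (fun x : tensor_dg E F => f (tens (dg_pr a x) w))
    (fun x : tensor_dg E F => g (tens (dg_pr a x) w)));
    [lin|lin|].
  move=> a' b u v hu hv; rewrite (tprE _ hu hv); case: ifP => [_|_].
    exact: e hu hv hw.
  by rewrite (lin0 (tens_linear_l _)) (lin0 fL) (lin0 gL).
have alE u v w : al (tens (tens u v) w) = tens u (tens v w) by exact: tassoc_tens.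
split=> //.
- by rewrite /= alE.
- move=> x y; move: x; apply: (@ext _); [lin|lin|].
  move=> a b c u v w hu hv hw; move: y; apply: (@ext _); [lin|lin|].
  move=> a' b' c' u' v' w' hu' hv' hw'.
  rewrite !alE (tmE _ _ hw (homog_tens hu' hv')) (tmE _ _ hv hu').
  rewrite (tmE _ _ (homog_tens hv hw) hu') (tmE _ _ hw hv').
  rewrite (linZ (tens_linear_l _)) (linZ (tens_linear_r _)) !(linZ aL) alE.
  by rewrite !scalerA -!exprD; congr (_ ^+ _ *: _); lia.
- apply: (@ext _); [lin|lin|] => a b c u v w hu hv hw.
  rewrite alE (tdE _ (homog_tens hu hv)) (tdE _ hu) (tdE _ hu) (tdE _ hv).
  rewrite !(linD aL) (linD (tens_linear_l _)) (linD (tens_linear_r _)).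
  rewrite (linZ (tens_linear_l _)) (linZ (tens_linear_r _)) (linD aL) !(linZ aL) !alE.
  by rewrite scalerDr scalerA exprD addrA.
- move=> n; apply: (@ext _); [lin|lin|] => a b c u v w hu hv hw.
  rewrite alE (tprE _ (homog_tens hu hv) hw) (tprE _ hu (homog_tens hv hw)) addnA.
  by case: ifP => _; rewrite ?alE // (lin0 aL).
Qed.

Definition triv_dg (A : algType k) : dgdata k :=
  {| dg_car := A; dg_mul := *%R; dg_one := 1; dg_d := fun=> 0;
     dg_pr := fun n x => if n == 0%N then x else 0 |}.

Lemma triv_dga_axioms A : dga_axioms (triv_dg A).
Proof.
split=> //=.
- split=> [z|z]; [exact: mul_linear_l|exact: mul_linear_r].
- exact: mulrA.
- exact: mul1r.
- exact: mulr1.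
- by move=> n c x y /=; case: ifP => // _; rewrite scaler0 addr0.
- by move=> m n x; case: n m => [|n] [|m] //=; case: ifP.
- by move=> x; exists 1%N; rewrite big_ord1.
- move=> [|m] [|n] x y; rewrite /homog //=;
    [move=> _ <-|move=> <- _|move=> <- _].
  + by rewrite mulr0.
  + by rewrite mul0r.
  + by rewrite mul0r.
- by move=> c x y; rewrite scaler0 addr0.
- by move=> n x y _; rewrite mul0r mulr0 scaler0 addr0.
Qed.

Canonical triv_dga A : dga k := DGA (triv_dga_axioms A).

Lemma triv_homog A (a : triv_dg A) : homog 0 a.
Proof. by []. Qed.

(** With one factor in degree 0 no Koszul sign survives, so product,
    differential and grading of the tensor product are those of the factors,
    for forms that need not be homogeneous. *)
Section TrivTensor.
Variables (A : algType k) (F : dga k).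
Let T := tensor_dg (triv_dg A) F.

Lemma triv_tens_mul (a b : A) (v w : F) :
  dg_mul (tens a v : T) (tens b w : T) = (tens (a * b) (dg_mul v w) : T).
Proof.
have [N ->] := dga_pr_sum (dga_ax F) v.
rewrite (lin_sum (tens_linear_r _)) (lin_sum (dg_mul_linear_l erefl _)).
rewrite (lin_sum (dg_mul_linear_l erefl _)) (lin_sum (tens_linear_r _)).
apply: eq_bigr => i _.
by rewrite (tmE _ _ (pr_homog i v) (triv_homog b)) muln0 scale1r.
Qed.

Lemma triv_tens_d (a : A) (v : F) : dg_d (tens a v : T) = tens a (dg_d v).
Proof.
by rewrite (tdE _ (triv_homog a)) (lin0 (tens_linear_l _)) add0r scale1r.
Qed.

Lemma triv_tens_pr n (a : A) (v : F) : dg_pr n (tens a v : T) = tens a (dg_pr n v).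
Proof.
have [N ->] := dga_pr_sum (dga_ax F) v.
have L := dga_pr_linear (dga_ax F) n.
rewrite (lin_sum (tens_linear_r _)) (lin_sum L) (lin_sum (tpr_linear n)).
rewrite (lin_sum (tens_linear_r _)); apply: eq_bigr => i _.
rewrite (tprE _ (triv_homog a) (pr_homog i v)) add0n (dga_prK (dga_ax F)).
by case: ifP => // _; rewrite (lin0 (tens_linear_r _)).
Qed.

End TrivTensor.
End Morphisms.

(** * The left coaction on forms *)

Lemma amul_dg_mul (k : fieldType) (A B : algType k) (x y : tensor A B) :
  amul x y = dg_mul (x : tensor_dg (triv_dg A) (triv_dg B)) y.
Proof.
have mB (C : algType k) : bilin (@GRing.mul C) by lin.
have aB : bilin (@amul k A B) by exact: tmap2_bilin.
move: x; apply: linear_tensor_ext => [||a b]; [lin|lin|].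
move: y; apply: linear_tensor_ext => [||a' b']; [lin|lin|].
by rewrite amul_tens triv_tens_mul.
Qed.

Lemma triv_dg_morphism (k : fieldType) (A B C : algType k) (f : A -> tensor B C) :
  linear f -> f 1 = tens 1 1 -> (forall a b, f (a * b) = amul (f a) (f b)) ->
  dg_morphism (f : triv_dg A -> tensor_dg (triv_dg B) (triv_dg C)).
Proof.
move=> fL f1 fM; split=> //.
- by move=> a b; rewrite -amul_dg_mul -fM.
- move=> a; rewrite /= (lin0 fL); move: (f a).
  apply: (@linear_tensor_ext _ _ _ _ (fun=> 0)
    (@dg_d k (tensor_dg (triv_dg B) (triv_dg C)))) => [||b c]; [exact: lin_const0|lin|].
  by rewrite triv_tens_d (lin0 (tens_linear_r _)).
- move=> n a.
  have -> : dg_pr n (f a : tensor_dg (triv_dg B) (triv_dg C)) = if n == 0%N then f a else 0.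
    move: (f a).
    apply: (@linear_tensor_ext _ _ _ _ (@dg_pr k (tensor_dg (triv_dg B) (triv_dg C)) n)
      (fun x => if n == 0%N then x else 0)) => [||b c]; first lin.
    - by case: (n == 0%N); [exact: lin_id|exact: lin_const0].
    - rewrite (@triv_tens_pr _ B (triv_dga C)) /=; case: ifP => // _.
      by rewrite (lin0 (tens_linear_r _)).
  by rewrite /=; case: ifP => // _; rewrite (lin0 fL).
Qed.

Section HopfLinear.
Variables (k : fieldType) (H : hopfAlgebra k).

Lemma hopf_eps_scale_linear (V : lmodType k) (v : V) :
  linear (fun h : H => hopf_eps h *: v).
Proof.
move=> c x y; rewrite (hopf_eps_linear (hopf_ax H)) scalerDl.
by congr (_ + _); rewrite scalerA.
Qed.

Lemma hopf_Delta_dg_morphism :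
  dg_morphism (@hopf_Delta k H : triv_dg H -> tensor_dg (triv_dg H) (triv_dg H)).
Proof.
have ax := hopf_ax H; apply: triv_dg_morphism.
- exact: hopf_Delta_linear ax.
- exact: hopf_Delta1 ax.
- exact: hopf_DeltaM ax.
Qed.

Lemma hopf_S1 : hopf_S (1 : H) = 1.
Proof.
have ax := hopf_ax H; have SL := hopf_S_linear ax.
have := hopf_antipodel ax 1.
rewrite (hopf_Delta1 ax) tlift_tens; last by lin.
by rewrite mulr1 (hopf_eps1 ax) scale1r.
Qed.

End HopfLinear.

Section CoinvariantForms.
Variables (k : fieldType) (H : hopfAlgebra k) (O : hopfCalculus H).

Let axH := hopf_ax H.
Let cal : calculus_axioms (hc_in O) := mp_cal (hc_max O).
Let axO := dga_ax O.

Lemma hc_in_linear : linear (hc_in O).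
Proof. exact: cal_linear cal. Qed.

Lemma hc_Delta_linear : linear (@hc_Delta k H O : O -> tensor O O).
Proof. exact: dgm_linear (hc_Delta_morph O). Qed.

Fact deg0_subproof (w : O) : exists h, dg_pr 0 w = hc_in O h.
Proof. by apply/(cal_deg0 cal); exact: pr_homog. Qed.

(** Degree 0 of Omega(H) is the image of H, so the degree-0 component of a form
    can be read as an element of H. *)
Definition deg0 (w : O) : H := sval (cid (deg0_subproof w)).

Lemma deg0E w : hc_in O (deg0 w) = dg_pr 0 w.
Proof. by rewrite /deg0; case: cid. Qed.

Lemma deg0_in h : deg0 (hc_in O h) = h.
Proof. by apply: (cal_inj cal); rewrite deg0E; exact: cal_homog. Qed.

Lemma deg0_pr0 w : deg0 (dg_pr 0 w) = deg0 w.
Proof. by apply: (cal_inj cal); rewrite !deg0E (dga_prK axO). Qed.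

Lemma deg0_homogS n w : homog n.+1 w -> deg0 w = 0.
Proof.
move=> hw; apply: (cal_inj cal).
by rewrite deg0E -hw (dga_prK axO) /= (lin0 hc_in_linear).
Qed.

Lemma deg0_linear : linear deg0.
Proof.
move=> c x y; apply: (cal_inj cal).
by rewrite hc_in_linear !deg0E (dga_pr_linear axO).
Qed.

(** The forms of positive degree are an ideal containing all differentials, and
    [deg0] is the quotient map. *)
Lemma deg0_dg_morphism : dg_morphism (deg0 : O -> triv_dg H).
Proof.
have L := deg0_linear; have d1 : deg0 dg_one = 1 by rewrite -(cal_one cal) deg0_in.
split=> //.
- move=> x y; rewrite [RHS]/=.
  have [N ->] := dga_pr_sum axO x; have [M ->] := dga_pr_sum axO y.
  rewrite (lin_sum (dg_mul_linear_l erefl _)) !(lin_sum L) mulr_suml.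
  apply: eq_bigr => m _.
  rewrite (lin_sum (dg_mul_linear_r erefl _)) (lin_sum L) mulr_sumr.
  apply: eq_bigr => n _; have hm := pr_homog m x; have hn := pr_homog n y.
  case: (nat_of_ord m) hm => [|a] hm.
    case: (nat_of_ord n) hn => [|b] hn.
      have [g ->] := (cal_deg0 cal _).1 hm; have [h ->] := (cal_deg0 cal _).1 hn.
      by rewrite -(cal_mul cal) !deg0_in.
    have := dga_homogM axO hm hn => /deg0_homogS ->.
    by rewrite (deg0_homogS hn) mulr0.
  have := dga_homogM axO hm hn; rewrite addSn => /deg0_homogS ->.
  by rewrite (deg0_homogS hm) mul0r.
- move=> x; have [N ->] := dga_pr_sum axO x.
  rewrite (lin_sum (dg_d_linear erefl)) (lin_sum L) big1 // => n _.
  exact: deg0_homogS (dga_homog_d axO (pr_homog n x)).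
- move=> [|n] x /=; first exact: deg0_pr0.
  exact: deg0_homogS (pr_homog _ _).
Qed.

(** The left coaction lambda, with values in H rather than in its copy in
    Omega(H). *)
Definition left_coact (w : O) : tensor H O := tmap deg0 id (hc_Delta w).

Lemma left_coact_dg_morphism : dg_morphism (left_coact : O -> tensor_dg (triv_dg H) O).
Proof.
apply: (@dg_morphism_comp _ _ _ _ (tmap deg0 id : tensor_dg O O -> tensor_dg (triv_dg H) O)).
  apply: (@tmap_dg_morphism k O O (triv_dga H) O); last exact: dg_morphism_id.
  exact: deg0_dg_morphism.
exact: hc_Delta_morph.
Qed.

Lemma left_coact_linear : linear left_coact.
Proof. exact: dgm_linear left_coact_dg_morphism. Qed.

Ltac lin_atom ::= first
  [ exact: tassoc_linear
  | exact: (hopf_Delta_linear axH) | exact: (hopf_S_linear axH)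
  | exact: hopf_eps_scale_linear
  | exact: hc_in_linear | exact: hc_Delta_linear
  | exact: deg0_linear | exact: left_coact_linear ].

Lemma left_coact_in h : left_coact (hc_in O h) = tmap id (hc_in O) (hopf_Delta h).
Proof.
rewrite /left_coact hc_Delta_in tmap_comp; [|lin|lin|lin|lin].
by apply: eq_tmap => // g; exact: deg0_in.
Qed.

(** Both sides are morphisms into H (x) (H (x) Omega(H)), so it is enough to
    compare them on H, where this is coassociativity of the coproduct. *)
Lemma left_coact_coassoc w :
  tassoc (tmap (@hopf_Delta k H) id (left_coact w)) = tmap id left_coact (left_coact w).
Proof.
pose T := tensor_dga (triv_dga H) (tensor_dga (triv_dga H) O).
move: w; apply: (calculus_morphism_ext cal (F := T)
  (f := fun w => tassoc (tmap (@hopf_Delta k H) id (left_coact w)))).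
- apply: dg_morphism_comp (tassoc_dg_morphism _ _ _) _.
  apply: dg_morphism_comp left_coact_dg_morphism.
  exact: (@tmap_dg_morphism k (triv_dga H) O (tensor_dga (triv_dga H) (triv_dga H)) O _ _
    (hopf_Delta_dg_morphism H) (dg_morphism_id _)).
- apply: dg_morphism_comp left_coact_dg_morphism.
  exact: (@tmap_dg_morphism k (triv_dga H) O (triv_dga H) (tensor_dga (triv_dga H) O) _ _
    (dg_morphism_id _) left_coact_dg_morphism).
move=> h; rewrite left_coact_in !tmap_comp; try lin.
transitivity (tassoc (tmap (tmap id id) (hc_in O) (tmap (@hopf_Delta k H) id (hopf_Delta h)))).
  by rewrite tmap_comp; try lin; congr tassoc; apply: eq_tmap => // x; rewrite tmap_id.
rewrite tassoc_tmap; try lin.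
rewrite (hopf_coassoc axH) tmap_comp; try lin.
by apply: eq_tmap => // x; rewrite left_coact_in.
Qed.

(** The counit contraction of H (x) Omega(H) is multiplicative, so again only
    the case of H matters. *)
Lemma left_coact_counit w : tlift (fun h v => hopf_eps h *: v) (left_coact w) = w.
Proof.
have eB : bilin (fun (h : H) (v : O) => hopf_eps h *: v) by lin.
pose e : tensor_dg (triv_dg H) O -> O := tlift (fun h v => hopf_eps h *: v).
have eL : linear e by rewrite /e; lin.
have eE h v : e (tens h v) = hopf_eps h *: v by exact: tlift_tens.
have eM : dg_morphism e.
  split=> //.
  - by rewrite eE (hopf_eps1 axH) scale1r.
  - move=> x y; move: x; apply: linear_tensor_ext => [||h v]; [lin|lin|].
    move: y; apply: linear_tensor_ext => [||g u]; [lin|lin|].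
    rewrite triv_tens_mul !eE (hopf_epsM axH) (linZ (dg_mul_linear_l erefl _)).
    by rewrite (linZ (dg_mul_linear_r erefl _)) scalerA.
  - apply: linear_tensor_ext => [||h v]; [lin|lin|].
    by rewrite triv_tens_d !eE (linZ (dg_d_linear erefl)).
  - move=> n; apply: linear_tensor_ext => [||h v]; [lin|lin|].
    by rewrite triv_tens_pr !eE (linZ (dg_pr_linear erefl n)).
move: w; apply: (calculus_morphism_ext cal (f := fun w => e (left_coact w))).
- exact: dg_morphism_comp eM left_coact_dg_morphism.
- exact: dg_morphism_id.
move=> h; rewrite left_coact_in /e tlift_tmap; try lin.
rewrite -[in RHS](hopf_counitl axH h) (lin_tlift _ hc_in_linear); last lin.
by apply: eq_tlift => x y; rewrite (linZ hc_in_linear).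
Qed.

(** The coproduct on forms is left colinear, for the coaction on the first leg
    of its target. *)
Lemma left_coact_Delta w :
  tassoc (tmap left_coact id (hc_Delta w)) = tmap id (@hc_Delta k H O) (left_coact w).
Proof.
pose T := tensor_dga (triv_dga H) (tensor_dga O O).
move: w; apply: (calculus_morphism_ext cal (F := T)
  (f := fun w => tassoc (tmap left_coact id (hc_Delta w)))).
- apply: dg_morphism_comp (tassoc_dg_morphism _ _ _) _.
  apply: dg_morphism_comp (hc_Delta_morph O).
  exact: (@tmap_dg_morphism k O O (tensor_dga (triv_dga H) O) O _ _
    left_coact_dg_morphism (dg_morphism_id _)).
- apply: dg_morphism_comp left_coact_dg_morphism.
  exact: (@tmap_dg_morphism k (triv_dga H) O (triv_dga H) (tensor_dga O O) _ _
    (dg_morphism_id _) (hc_Delta_morph O)).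
move=> h; rewrite left_coact_in hc_Delta_in !tmap_comp; try lin.
transitivity (tassoc (tmap (tmap id (hc_in O)) (hc_in O)
    (tmap (@hopf_Delta k H) id (hopf_Delta h)))).
  by rewrite tmap_comp; try lin; congr tassoc; apply: eq_tmap => // x; rewrite left_coact_in.
rewrite tassoc_tmap; try lin.
rewrite (hopf_coassoc axH) tmap_comp; try lin.
by apply: eq_tmap => // x; rewrite hc_Delta_in.
Qed.

(** Coinvariance is phrased with the first leg in Omega(H); since H is all of
    degree 0 there, it can be tested with the first leg in H. *)
Lemma lcoinvE (w : O) : (w \in @lcoinv k H O) <-> left_coact w = tens 1 w.
Proof.
have d1 : deg0 dg_one = 1 := dgm_one deg0_dg_morphism.
split=> [/lcoinvP e|e].
  have := congr1 (tmap deg0 id) e; rewrite tmap_tens; try lin.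
  rewrite tmap_comp; try lin.
  by rewrite d1 => <-; apply: eq_tmap => // x; rewrite deg0_pr0.
apply/lcoinvP; have := congr1 (tmap (hc_in O) id) e; rewrite tmap_tens; try lin.
rewrite /left_coact tmap_comp; try lin.
by rewrite (cal_one cal) => <-; apply: eq_tmap => // x; rewrite deg0E.
Qed.

(** Linear maps H -> T act on linear maps Omega(H) -> T by convolution along
    lambda.  An algebra map j has the convolution inverse j o S, so convolution
    with it can be cancelled. *)
Section Convolution.
Variable T : dga k.
Implicit Types (j : H -> T) (f : O -> T).

Definition conv j f (w : O) : T := tlift (fun h v => dg_mul (j h) (f v)) (left_coact w).

Lemma conv_linear j f : linear j -> linear f -> linear (conv j f).
Proof. move=> jL fL; rewrite /conv; lin. Qed.

(** Coassociativity of lambda makes convolution an action. *)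
Lemma conv_conv j1 j2 f w : linear j1 -> linear j2 -> linear f ->
  conv j1 (conv j2 f) w =
  conv (fun h => tlift (fun x y => dg_mul (j1 x) (j2 y)) (hopf_Delta h)) f w.
Proof.
move=> j1L j2L fL.
pose F := tlift (fun x z => dg_mul (j1 x) (tlift (fun y v => dg_mul (j2 y) (f v)) z)).
have FB : bilin (fun x (z : tensor H O) =>
  dg_mul (j1 x) (tlift (fun y v => dg_mul (j2 y) (f v)) z)) by lin.
have FL : linear F by rewrite /F; lin.
transitivity (F (tmap id left_coact (left_coact w))).
  by rewrite /F tlift_tmap //; lin.
rewrite -left_coact_coassoc /conv; move: (left_coact w).
apply: linear_tensor_ext => [||h v]; [lin|lin|].
rewrite tmap_tens; try lin; rewrite tlift_tens; try lin.
move: (hopf_Delta h); apply: linear_tensor_ext => [||x y]; [lin|lin|].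
rewrite tassoc_tens /F !tlift_tens; try lin.
by rewrite (dga_mulA (dga_ax T)).
Qed.

Variables (j : H -> T) (f : O -> T).
Hypotheses (jL : linear j) (fL : linear f) (j1 : j 1 = dg_one).
Hypothesis jM : forall g h, j (g * h) = dg_mul (j g) (j h).

Let conv_unit j' w : linear j' ->
  (forall h, j' h = hopf_eps h *: dg_one) -> conv j' f w = f w.
Proof.
move=> j'L e; rewrite -{2}[w]left_coact_counit (lin_tlift _ fL); last by lin.
apply: eq_tlift => h v; rewrite e (linZ (dg_mul_linear_l erefl _)).
by rewrite (dga_mul1 (dga_ax T)) (linZ fL).
Qed.

Lemma conv_antipodeK w : conv (fun h => j (hopf_S h)) (conv j f) w = f w.
Proof.
rewrite conv_conv; try lin; apply: conv_unit => [|h]; first lin.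
transitivity (j (tlift (fun x y => hopf_S x * y) (hopf_Delta h))).
  by rewrite (lin_tlift _ jL); try lin; apply: eq_tlift => x y; rewrite jM.
by rewrite (hopf_antipodel axH) (linZ jL) j1.
Qed.

Lemma conv_antipodeVK w : conv j (conv (fun h => j (hopf_S h)) f) w = f w.
Proof.
rewrite conv_conv; try lin; apply: conv_unit => [|h]; first lin.
transitivity (j (tlift (fun x y => x * hopf_S y) (hopf_Delta h))).
  by rewrite (lin_tlift _ jL); try lin; apply: eq_tlift => x y; rewrite jM.
by rewrite (hopf_antipoder axH) (linZ jL) j1.
Qed.

End Convolution.

(** * The projection onto coinvariant forms *)

(** P(w) = S(w_{-1}) w_0. *)
Definition coinv_proj (w : O) : O := conv (fun h => hc_in O (hopf_S h)) id w.

Lemma coinv_proj_linear : linear coinv_proj.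
Proof. by apply: conv_linear; lin. Qed.

Ltac lin_atom ::= first
  [ exact: tassoc_linear
  | exact: (hopf_Delta_linear axH) | exact: (hopf_S_linear axH)
  | exact: hopf_eps_scale_linear
  | exact: hc_in_linear | exact: hc_Delta_linear
  | exact: deg0_linear | exact: left_coact_linear | exact: coinv_proj_linear ].

Lemma coinv_projE w :
  coinv_proj w = tlift (fun h v => dg_mul (hc_in O (hopf_S h)) v) (left_coact w).
Proof. by []. Qed.

(** Omega(H) is generated over H by coinvariant forms:
    w = w_{-1} P(w_0), because P is the convolution of i o S with the
    identity. *)
Lemma coinv_proj_decomp w :
  tlift (fun h v => dg_mul (hc_in O h) (coinv_proj v)) (left_coact w) = w.
Proof.
apply: (conv_antipodeVK (T := O) (j := hc_in O) (f := id)); try lin.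
- exact: cal_one cal.
- exact: cal_mul cal.
Qed.

(** Convolving either lambda o P or w |-> 1 (x) P(w) with the algebra map
    lambda o i gives lambda: the former because lambda is multiplicative and
    w = w_{-1} P(w_0), the latter by coassociativity.  Convolution with an
    algebra map is injective, so the two maps agree. *)
Lemma coinv_projP w : coinv_proj w \in @lcoinv k H O.
Proof.
apply/lcoinvE; pose T := tensor_dga (triv_dga H) O.
pose j h : T := left_coact (hc_in O h); have lM := left_coact_dg_morphism.
have jL : linear j by rewrite /j; lin.
have j1 : j 1 = dg_one by rewrite /j (cal_one cal) (dgm_one lM).
have jM g h : j (g * h) = dg_mul (j g) (j h) by rewrite /j (cal_mul cal) (dgm_mul lM).
pose F v : T := left_coact (coinv_proj v); pose G v : T := tens 1 (coinv_proj v).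
have FL : linear F by rewrite /F; lin.
have GL : linear G by rewrite /G; lin.
have cB : bilin (fun h v => dg_mul (hc_in O h) (coinv_proj v)) by lin.
have cF v : conv j F v = left_coact v.
  rewrite -[in RHS](coinv_proj_decomp v) (lin_tlift _ left_coact_linear) //.
  by apply: eq_tlift => h u; rewrite (dgm_mul lM).
have cG v : conv j G v = left_coact v.
  pose c := tlift (fun h v => dg_mul (hc_in O h) (coinv_proj v)).
  have cL : linear c by rewrite /c; lin.
  transitivity (tmap id c (tassoc (tmap (@hopf_Delta k H) id (left_coact v)))); last first.
    rewrite left_coact_coassoc tmap_comp; try lin.
    by rewrite -[RHS]tmap_id; apply: eq_tmap => // u; exact: coinv_proj_decomp.
  rewrite /conv /j; move: (left_coact v); apply: linear_tensor_ext => [||h u]; [lin|lin|].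
  rewrite tmap_tens; try lin; rewrite tlift_tens; try lin; rewrite left_coact_in /G.
  move: (hopf_Delta h); apply: linear_tensor_ext => [||x y]; [lin|lin|].
  rewrite tassoc_tens !tmap_tens; try lin.
  by rewrite triv_tens_mul mulr1 /c tlift_tens.
rewrite -/(F w) -/(G w) -(conv_antipodeK jL FL j1 jM) -(conv_antipodeK jL GL j1 jM).
by apply: eq_tlift => h v; rewrite cF cG.
Qed.

Lemma left_coact_mul_coinv w th : th \in @lcoinv k H O ->
  left_coact (dg_mul w th) = tmap id (fun v => dg_mul v th) (left_coact w).
Proof.
move=> /lcoinvE e; rewrite (dgm_mul left_coact_dg_morphism) e.
move: (left_coact w); apply: linear_tensor_ext => [||h v]; [lin|lin|].
by rewrite tmap_tens; try lin; rewrite triv_tens_mul mulr1.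
Qed.

Lemma coinv_proj_mul w th : th \in @lcoinv k H O ->
  coinv_proj (dg_mul w th) = dg_mul (coinv_proj w) th.
Proof.
move=> hth; rewrite !coinv_projE left_coact_mul_coinv // tlift_tmap; try lin.
rewrite (lin_tlift _ (dg_mul_linear_l erefl th)); last lin.
by apply: eq_tlift => h v; rewrite (dga_mulA axO).
Qed.

Lemma coinv_proj_in h : coinv_proj (hc_in O h) = hopf_eps h *: dg_one.
Proof.
rewrite coinv_projE left_coact_in tlift_tmap; try lin.
transitivity (hc_in O (tlift (fun x y => hopf_S x * y) (hopf_Delta h))).
  rewrite (lin_tlift _ hc_in_linear); last lin.
  by apply: eq_tlift => x y; rewrite (cal_mul cal).
by rewrite (hopf_antipodel axH) (linZ hc_in_linear) (cal_one cal).
Qed.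

Lemma coinv_proj_in_mul h th : th \in @lcoinv k H O ->
  coinv_proj (dg_mul (hc_in O h) th) = hopf_eps h *: th.
Proof.
move=> hth; rewrite coinv_proj_mul // coinv_proj_in (linZ (dg_mul_linear_l erefl _)).
by rewrite (dga_mul1 axO).
Qed.

Lemma coinv_proj_id th : th \in @lcoinv k H O -> coinv_proj th = th.
Proof.
move=> /(coinv_proj_in_mul 1); rewrite (cal_one cal) (dga_mul1 axO).
by rewrite (hopf_eps1 axH) scale1r.
Qed.

Lemma lcoinv1 : (dg_one : O) \in @lcoinv k H O.
Proof. by apply/lcoinvE; rewrite (dgm_one left_coact_dg_morphism). Qed.

Lemma lcoinvM th et : th \in @lcoinv k H O -> et \in @lcoinv k H O ->
  dg_mul th et \in @lcoinv k H O.
Proof.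
move=> /lcoinvE h1 /lcoinvE h2; apply/lcoinvE.
by rewrite (dgm_mul left_coact_dg_morphism) h1 h2 triv_tens_mul mulr1.
Qed.

Lemma lcoinv_d th : th \in @lcoinv k H O -> dg_d th \in @lcoinv k H O.
Proof.
move=> /lcoinvE h; apply/lcoinvE.
by rewrite (dgm_d left_coact_dg_morphism) h triv_tens_d.
Qed.

Lemma lcoinv_pr n th : th \in @lcoinv k H O -> dg_pr n th \in @lcoinv k H O.
Proof.
move=> /lcoinvE h; apply/lcoinvE.
by rewrite (dgm_pr left_coact_dg_morphism) h triv_tens_pr.
Qed.

(** [to_coinv] itself is not linear; composed with P it is, and the two agree on
    coinvariant forms. *)
Definition to_coinv_proj (w : O) : coinv_forms O := to_coinv (coinv_proj w).

Lemma val_to_coinv (w : O) : w \in @lcoinv k H O -> val (to_coinv w) = w.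
Proof. by move=> hw; rewrite /to_coinv insubdK. Qed.

Lemma to_coinvE (w : O) : w \in @lcoinv k H O -> to_coinv w = to_coinv_proj w.
Proof. by move=> hw; rewrite /to_coinv_proj coinv_proj_id. Qed.

Lemma val_to_coinv_proj w : val (to_coinv_proj w) = coinv_proj w.
Proof. by rewrite val_to_coinv // coinv_projP. Qed.

Lemma to_coinv_proj_linear : linear to_coinv_proj.
Proof.
move=> c x y; apply: val_inj.
by rewrite /= !val_to_coinv_proj coinv_proj_linear.
Qed.

Lemma coinv_val_linear : linear (val : coinv_forms O -> O).
Proof. by []. Qed.

(** For coinvariant th the map h |-> th h is left colinear, and so is
    h |-> d h below.  For such a map f, P(f h) = S(h_1) f(h_2), which makes P
    the source of both the right action and the form varpi. *)
Lemma left_coact_coinv_mul_in th h : th \in @lcoinv k H O ->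
  left_coact (dg_mul th (hc_in O h)) = tmap id (fun g => dg_mul th (hc_in O g)) (hopf_Delta h).
Proof.
move=> /lcoinvE e; rewrite (dgm_mul left_coact_dg_morphism) e left_coact_in.
move: (hopf_Delta h); apply: linear_tensor_ext => [||x y]; [lin|lin|].
by rewrite !tmap_tens; try lin; rewrite triv_tens_mul mul1r.
Qed.

Lemma left_coact_d_in h :
  left_coact (dg_d (hc_in O h)) = tmap id (fun g => dg_d (hc_in O g)) (hopf_Delta h).
Proof.
rewrite (dgm_d left_coact_dg_morphism) left_coact_in.
move: (hopf_Delta h); apply: linear_tensor_ext => [||x y]; [lin|lin|].
by rewrite !tmap_tens; try lin; rewrite triv_tens_d.
Qed.

Lemma form_ractE th h : th \in @lcoinv k H O ->
  form_ract th h = coinv_proj (dg_mul th (hc_in O h)).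
Proof.
move=> hth; rewrite coinv_projE left_coact_coinv_mul_in // tlift_tmap; try lin.
by apply: eq_tlift => x y; rewrite (dga_mulA axO).
Qed.

Lemma varpiE h : varpi O h = coinv_proj (dg_d (hc_in O h)).
Proof. by rewrite coinv_projE left_coact_d_in tlift_tmap; try lin. Qed.

(** varpi kills constants since d 1 = 0. *)
Lemma varpi_pi_eps h : varpi O (pi_eps h) = varpi O h.
Proof.
have L : linear (fun g => coinv_proj (dg_d (hc_in O g))) by lin.
rewrite !varpiE /pi_eps -scaleN1r addrC L (linZ L) (cal_one cal) dga_d1.
by rewrite (lin0 coinv_proj_linear) !scaler0 add0r.
Qed.

End CoinvariantForms.

(** * The embedding of vertical forms *)

Section Vertical.
Variables (k : fieldType) (H : hopfAlgebra k) (O : hopfCalculus H) (A : comodAlgebra H).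

Let axH := hopf_ax H.
Let cal : calculus_axioms (hc_in O) := mp_cal (hc_max O).
Let axO := dga_ax O.
Let axA := ca_coactP A.
Let T := tensor_dg (triv_dg A) O.

Lemma ca_coact_linear : linear (@ca_coact k H A).
Proof. by case: axA. Qed.

Lemma ca_coact_coassoc a : tassoc (tmap (@ca_coact k H A) id (ca_coact a)) =
  tmap id (@hopf_Delta k H) (@ca_coact k H A a).
Proof. by case: axA. Qed.

Lemma ca_coact_counit (a : A) : tlift (fun b h => hopf_eps h *: b) (ca_coact a) = a.
Proof. by case: axA. Qed.

Ltac lin_atom ::= first
  [ exact: tassoc_linear
  | exact: (hopf_Delta_linear axH) | exact: (hopf_S_linear axH)
  | exact: hopf_eps_scale_linear
  | exact: hc_in_linear | exact: hc_Delta_linear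
  | exact: coinv_proj_linear | exact: to_coinv_proj_linear
  | exact: coinv_val_linear | exact: ca_coact_linear ].

(** The coaction of A, a |-> a_0 (x) i(a_1), read in A (x) Omega(H). *)
Definition form_coact (a : A) : T := tmap id (hc_in O) (ca_coact a).

Lemma form_coact_linear : linear form_coact.
Proof. rewrite /form_coact; lin. Qed.

Lemma form_coact1 : form_coact 1 = dg_one.
Proof. by rewrite /form_coact ca_coact1 tmap_tens; try lin; rewrite (cal_one cal). Qed.

Lemma form_coactM a b : form_coact (a * b) = dg_mul (form_coact a) (form_coact b).
Proof.
have mB (B : algType k) : bilin (@GRing.mul B) by lin.
have aB : bilin (@amul k A H) by exact: tmap2_bilin.
rewrite /form_coact ca_coactM.
move: (ca_coact a); apply: linear_tensor_ext => [||c g]; [lin|lin|].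
move: (ca_coact b); apply: linear_tensor_ext => [||d h]; [lin|lin|].
rewrite amul_tens !tmap_tens; try lin.
by rewrite triv_tens_mul (cal_mul cal).
Qed.

Lemma form_coact_homog a : homog 0 (form_coact a).
Proof.
rewrite /homog /form_coact; move: (ca_coact a).
apply: linear_tensor_ext => [||c g]; [lin|lin|].
by rewrite tmap_tens; try lin; rewrite triv_tens_pr (cal_homog cal).
Qed.

(** For f left colinear, h_1 P(f(h_2)) = f(h); applying this to the second leg
    of a_0 (x) a_1 gives a_0 (x) a_1 P(f(a_2)) = a_0 (x) f(a_1).  With
    f = th i(-) and f = d o i it untwists the product and the differential of
    vertical forms. *)
Lemma form_coact_colinear (f : H -> O) a : linear f ->
  (forall h, left_coact (f h) = tmap id f (hopf_Delta h)) ->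
  tlift (fun b h => dg_mul (form_coact b) (tens 1 (coinv_proj (f h)) : T)) (ca_coact a) =
  tmap id f (ca_coact a).
Proof.
move=> fL fE.
pose c := tlift (fun g h => dg_mul (hc_in O g) (coinv_proj (f h))).
have cB : bilin (fun g h => dg_mul (hc_in O g) (coinv_proj (f h))) by lin.
have cL : linear c by rewrite /c; lin.
transitivity (tmap id c (tassoc (tmap (@ca_coact k H A) id (ca_coact a)))).
  rewrite /form_coact.
  move: (ca_coact a); apply: linear_tensor_ext => [||b h]; [lin|lin|].
  rewrite tlift_tens ?tmap_tens; try lin.
  move: (ca_coact b); apply: linear_tensor_ext => [||d g]; [lin|lin|].
  rewrite tassoc_tens !tmap_tens; try lin.
  by rewrite triv_tens_mul mulr1 /c tlift_tens.
rewrite ca_coact_coassoc tmap_comp; try lin; apply: eq_tmap => // h.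
rewrite -[RHS]coinv_proj_decomp fE tlift_tmap //; lin.
Qed.

(** J(a (x) th) = a_0 (x) a_1 th, written as the product of a_0 (x) a_1 and
    1 (x) th so that the algebra structure of the target can be used. *)
Definition ver_emb (x : ver_dg O A) : T :=
  tlift (fun a (th : coinv_forms O) =>
    dg_mul (form_coact a) (tens 1 (val th) : T)) x.

Lemma ver_emb_bilin : bilin (fun a (th : coinv_forms O) =>
    dg_mul (form_coact a) (tens 1 (val th) : T)).
Proof. have L := form_coact_linear; lin. Qed.

Lemma ver_emb_linear : linear ver_emb.
Proof. exact: tlift_linear ver_emb_bilin. Qed.

Lemma ver_emb_tens (a : A) (th : coinv_forms O) :
  ver_emb (tens a th) = dg_mul (form_coact a) (tens 1 (val th) : T).
Proof. exact: tlift_tens ver_emb_bilin. Qed.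

Definition ver_proj (x : T) : ver_dg O A := tmap id (@to_coinv_proj k H O) x.

Lemma ver_proj_linear : linear ver_proj.
Proof. rewrite /ver_proj; lin. Qed.

(** a_0 (x) P(a_1 th) = a_0 (x) epsilon(a_1) th = a (x) th. *)
Lemma ver_embK : cancel ver_emb ver_proj.
Proof.
move=> x; move: x; have L := ver_emb_linear; have L' := ver_proj_linear.
apply: linear_tensor_ext => [||a th]; [lin|lin|].
rewrite ver_emb_tens -[in RHS](ca_coact_counit a) /ver_proj /form_coact.
move: (ca_coact a); apply: linear_tensor_ext => [||b h]; [lin|lin|].
rewrite tmap_tens; try lin; rewrite triv_tens_mul tmap_tens; try lin.
rewrite mulr1 tlift_tens; try lin.
have -> : to_coinv_proj (dg_mul (hc_in O h) (val th)) = hopf_eps h *: th.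
  apply: val_inj; rewrite /= val_to_coinv_proj coinv_proj_in_mul //.
  exact: valP.
by rewrite (linZ (tens_linear_l _)) (linZ (tens_linear_r _)).
Qed.

Lemma val_lcoinv (th : coinv_forms O) : val th \in @lcoinv k H O.
Proof. exact: valP. Qed.

(** The operations of vertical forms rewritten through P, so that every
    expression in them is visibly linear. *)
Lemma ver_mulE (x y : ver_dg O A) : dg_mul x y =
  tlift (fun a (th : coinv_forms O) => tlift (fun b (et : coinv_forms O) =>
    tlift (fun b0 b1 => tens (a * b0)
      (to_coinv_proj (dg_mul (coinv_proj (dg_mul (val th) (hc_in O b1))) (val et))))
    (ca_coact b)) y) x.
Proof.
apply: eq_tlift => a th; apply: eq_tlift => b et; apply: eq_tlift => b0 b1.
rewrite form_ractE ?val_lcoinv // to_coinvE //.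
by apply: lcoinvM; [exact: coinv_projP|exact: val_lcoinv].
Qed.

Lemma ver_dE (x : ver_dg O A) : dg_d x =
  tlift (fun a (th : coinv_forms O) => tens a (to_coinv_proj (dg_d (val th))) +
    tlift (fun a0 a1 => tens a0
      (to_coinv_proj (dg_mul (coinv_proj (dg_d (hc_in O a1))) (val th)))) (ca_coact a)) x.
Proof.
apply: eq_tlift => a th; rewrite to_coinvE ?lcoinv_d ?val_lcoinv //; congr (_ + _).
apply: eq_tlift => a0 a1; rewrite varpi_pi_eps varpiE to_coinvE //.
by apply: lcoinvM; [exact: coinv_projP|exact: val_lcoinv].
Qed.

Lemma ver_prE n (x : ver_dg O A) :
  dg_pr n x = tmap id (fun th : coinv_forms O => to_coinv_proj (dg_pr n (val th))) x.
Proof.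
by apply: eq_tmap => // th; rewrite to_coinvE ?lcoinv_pr ?val_lcoinv.
Qed.

Lemma ver_emb_in a : ver_emb (ver_in O a) = form_coact a.
Proof.
rewrite ver_emb_tens val_to_coinv ?lcoinv1 //.
exact: (dga_mulr1 (dga_ax (tensor_dga (triv_dga A) O))).
Qed.

(** In J(a (x) th) J(b (x) et) the factor (1 (x) th)(b_0 (x) b_1) equals
    b_0 (x) b_1 P(th b_2) by [form_coact_colinear], and
    P(th b) = S(b_1) th b_2 is the right action in the twisted product. *)
Lemma ver_emb_mul x y : ver_emb (dg_mul x y) = dg_mul (ver_emb x) (ver_emb y).
Proof.
have L := ver_emb_linear; have L' := form_coact_linear.
have mA := dga_mulA (dga_ax (tensor_dga (triv_dga A) O)).
rewrite ver_mulE; move: x; apply: linear_tensor_ext => [||a th]; [lin|lin|].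
rewrite tlift_tens; try lin.
move: y; apply: linear_tensor_ext => [||b et]; [lin|lin|].
rewrite tlift_tens; try lin.
rewrite !ver_emb_tens -mA (lin_tlift _ L); try lin.
have e : dg_mul (tens 1 (val th) : T) (form_coact b) =
    tmap id (fun h => dg_mul (val th) (hc_in O h)) (ca_coact b).
  rewrite /form_coact; move: (ca_coact b).
  apply: linear_tensor_ext => [||c h]; [lin|lin|].
  by rewrite !tmap_tens; try lin; rewrite triv_tens_mul mul1r.
rewrite (mA (tens 1 (val th) : T)) e.
rewrite -(@form_coact_colinear (fun h => dg_mul (val th) (hc_in O h))); last first.
- by move=> h; rewrite left_coact_coinv_mul_in // val_lcoinv.
- lin.
rewrite (lin_tlift _ (dg_mul_linear_l erefl (tens 1 (val et) : T))); last lin.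
rewrite (lin_tlift _ (dg_mul_linear_r erefl (form_coact a))); last lin.
apply: eq_tlift => b0 b1; rewrite ver_emb_tens val_to_coinv_proj form_coactM.
rewrite coinv_proj_id; last first.
  by apply: lcoinvM; [exact: coinv_projP|exact: val_lcoinv].
by rewrite -!mA triv_tens_mul mulr1.
Qed.

(** d(a_0 (x) a_1) = a_0 (x) d a_1 = a_0 (x) a_1 P(d a_2), and P(d a) is
    varpi(a); the two terms of the Leibniz rule are those of the differential of
    vertical forms. *)
Lemma ver_emb_d x : ver_emb (dg_d x) = dg_d (ver_emb x).
Proof.
have L := ver_emb_linear; have L' := form_coact_linear.
have mA := dga_mulA (dga_ax (tensor_dga (triv_dga A) O)).
rewrite ver_dE; move: x; apply: linear_tensor_ext => [||a th]; [lin|lin|].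
rewrite tlift_tens; try lin.
rewrite !ver_emb_tens.
rewrite (dga_leibniz (dga_ax (tensor_dga (triv_dga A) O)) _ (form_coact_homog a)).
rewrite scale1r triv_tens_d (linD L) ver_emb_tens val_to_coinv_proj.
rewrite coinv_proj_id ?lcoinv_d ?val_lcoinv // addrC; congr (_ + _).
have e : dg_d (form_coact a) = tmap id (fun h => dg_d (hc_in O h)) (ca_coact a).
  rewrite /form_coact; move: (ca_coact a).
  apply: linear_tensor_ext => [||c h]; [lin|lin|].
  by rewrite !tmap_tens; try lin; rewrite triv_tens_d.
rewrite e -(@form_coact_colinear (fun h => dg_d (hc_in O h))); last first.
- by move=> h; rewrite left_coact_d_in.
- lin.
rewrite (lin_tlift _ (dg_mul_linear_l erefl (tens 1 (val th) : T))); last lin.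
rewrite (lin_tlift _ L); last lin.
apply: eq_tlift => b0 b1; rewrite ver_emb_tens val_to_coinv_proj.
rewrite coinv_proj_id; last first.
  by apply: lcoinvM; [exact: coinv_projP|exact: val_lcoinv].
by rewrite -!mA triv_tens_mul mulr1.
Qed.

Lemma ver_emb_pr n x : ver_emb (dg_pr n x) = dg_pr n (ver_emb x).
Proof.
have L := ver_emb_linear; have L' := form_coact_linear.
rewrite ver_prE; move: x; apply: linear_tensor_ext => [||a th]; [lin|lin|].
rewrite tmap_tens; try lin.
rewrite !ver_emb_tens (pr_mul0 (E := tensor_dga (triv_dga A) O) _ _ (form_coact_homog a)).
by rewrite triv_tens_pr val_to_coinv_proj coinv_proj_id ?lcoinv_pr ?val_lcoinv.
Qed.

Lemma ver_emb_dg_morphism : dg_morphism (ver_emb : ver_dg O A -> T).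
Proof.
split.
- exact: ver_emb_linear.
- by rewrite -form_coact1 -ver_emb_in.
- exact: ver_emb_mul.
- exact: ver_emb_d.
- exact: ver_emb_pr.
Qed.

Definition ver_dga : dga k :=
  DGA (dga_axioms_inj (T := tensor_dga (triv_dga A) O)
         (can_inj ver_embK) ver_emb_dg_morphism).

(** * The coaction on vertical forms *)

Local Notation V := ver_dga.
Local Notation A0 := (triv_dga A).
Let T2 := tensor_dg A0 (tensor_dg O O).

Ltac lin_atom ::= first
  [ exact: tassoc_linear
  | exact: (hopf_Delta_linear axH)
  | exact: hc_in_linear | exact: hc_Delta_linear
  | exact: coinv_proj_linear | exact: to_coinv_proj_linear
  | exact: coinv_val_linear | exact: ca_coact_linear
  | exact: form_coact_linear | exact: ver_emb_linear | exact: ver_proj_linear ].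

(** J (x) id, reassociated. *)
Definition ver_emb_tensor (x : tensor_dg V O) : T2 :=
  tassoc (tmap (ver_emb : V -> tensor_dg A0 O) id x).

(** The splitting a (x) (w (x) v) |-> (a (x) P(w)) (x) v of J (x) id. *)
Definition ver_proj_tensor (x : T2) : tensor_dg V O :=
  tlift (fun a => tmap (fun w => tens a (to_coinv_proj w) : V) (@id O)) x.

Lemma ver_proj_tensor_linear : linear ver_proj_tensor.
Proof. rewrite /ver_proj_tensor; lin. Qed.

Lemma ver_emb_tensor_linear : linear ver_emb_tensor.
Proof. rewrite /ver_emb_tensor; lin. Qed.

Lemma ver_emb_tensorK : cancel ver_emb_tensor ver_proj_tensor.
Proof.
have L := ver_proj_tensor_linear.
have e (y : tensor (tensor A O) O) : ver_proj_tensor (tassoc y) =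
    tmap (ver_proj : tensor_dg A0 O -> V) id y.
  move: y; apply: linear_tensor_ext_l => [||a w v]; [lin|lin|].
  rewrite tassoc_tens /ver_proj_tensor tlift_tens; try lin.
  by rewrite /ver_proj !tmap_tens; try lin.
move=> x; rewrite /ver_emb_tensor e tmap_comp; try lin.
by rewrite -[RHS]tmap_id; apply: eq_tmap => // y; exact: ver_embK.
Qed.

Lemma ver_emb_tensor_dg_morphism : dg_morphism (ver_emb_tensor : tensor_dg V O -> T2).
Proof.
apply: dg_morphism_comp (tassoc_dg_morphism _ _ _) _.
exact: (@tmap_dg_morphism k V O (tensor_dga A0 O) O _ _
  ver_emb_dg_morphism (dg_morphism_id _)).
Qed.

Definition ver_Delta (x : V) : T2 := tmap id (@hc_Delta k H O) (ver_emb x).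

Lemma ver_Delta_dg_morphism : dg_morphism (ver_Delta : V -> T2).
Proof.
apply: (dg_morphism_comp (F := tensor_dg A0 O)) _ ver_emb_dg_morphism.
exact: (@tmap_dg_morphism k A0 O A0 (tensor_dga O O) _ _
  (dg_morphism_id _) (hc_Delta_morph O)).
Qed.

Definition ver_coact (x : V) : tensor_dg V O := ver_proj_tensor (ver_Delta x).

(** On A both sides are a_0 (x) (a_1 (x) a_2), by coassociativity. *)
Lemma ver_emb_tensor_in a :
  ver_emb_tensor (tmap (@ver_in k H O A : A -> V) (hc_in O) (ca_coact a)) =
  ver_Delta (ver_in O a).
Proof.
have iL : linear (@ver_in k H O A : A -> V) by rewrite /ver_in; lin.
rewrite /ver_emb_tensor /ver_Delta ver_emb_in tmap_comp; try lin.
transitivity (tassoc (tmap (tmap id (hc_in O)) (hc_in O)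
    (tmap (@ca_coact k H A) id (ca_coact a)))).
  rewrite tmap_comp; try lin; congr tassoc; apply: eq_tmap => // b.
  by rewrite ver_emb_in.
rewrite tassoc_tmap; try lin; rewrite ca_coact_coassoc /form_coact !tmap_comp; try lin.
by apply: eq_tmap => // h; rewrite hc_Delta_in.
Qed.

(** By [left_coact_Delta], lambda(th_1) (x) th_2 = 1 (x) th_1 (x) th_2;
    multiplying S of the first leg onto the second gives
    P(th_1) (x) th_2 = th_1 (x) th_2. *)
Lemma hc_Delta_coinv th : th \in @lcoinv k H O ->
  tmap (@coinv_proj k H O) id (hc_Delta th) = hc_Delta th :> tensor O O.
Proof.
move=> /lcoinvE e.
pose m := tlift (fun h (z : tensor O O) =>
  tmap (fun w => dg_mul (hc_in O (hopf_S h)) w) (@id O) z).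
have SL := hopf_S_linear axH.
have mB : bilin (fun h (z : tensor O O) =>
  tmap (fun w => dg_mul (hc_in O (hopf_S h)) w) (@id O) z) by lin.
have mL : linear m by rewrite /m; lin.
have lL := @left_coact_linear k H O.
transitivity (m (tassoc (tmap (@left_coact k H O) id (hc_Delta th)))).
  move: (hc_Delta th : tensor O O); apply: linear_tensor_ext => [||w v]; [lin|lin|].
  rewrite !tmap_tens; try lin; rewrite coinv_projE.
  move: (left_coact w); apply: linear_tensor_ext => [||h u]; [lin|lin|].
  rewrite tassoc_tens tlift_tens; try lin.
  by rewrite /m tlift_tens // tmap_tens; try lin.
rewrite left_coact_Delta e tmap_tens; try lin; rewrite /m tlift_tens //.
rewrite -[RHS]tmap_id; apply: eq_tmap => // w.
by rewrite hopf_S1 (cal_one cal) (dga_mul1 axO).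
Qed.

(** [ver_coact] inverts J (x) id by a one-sided inverse, so the content is that
    the image of [ver_Delta] lies in the image of J (x) id. *)
Lemma ver_emb_coact x : ver_emb_tensor (ver_coact x) = ver_Delta x.
Proof.
have L := ver_emb_tensor_linear; have L' := ver_proj_tensor_linear.
have LD : linear (ver_Delta) := dgm_linear ver_Delta_dg_morphism.
have EM := ver_emb_tensor_dg_morphism.
move: x; apply: linear_tensor_ext => [||a th]; [rewrite /ver_coact; lin|lin|].
suff [y e] : exists y, ver_emb_tensor y = ver_Delta (tens a th).
  by rewrite /ver_coact -e ver_emb_tensorK.
pose e1 (w : O) : V := tens (1 : A) (to_coinv_proj w).
have e1L : linear e1 by rewrite /e1; lin.
(* The coactions of a (x) 1 and 1 (x) th, multiplied. *)
exists (dg_mul (tmap (@ver_in k H O A : A -> V) (hc_in O) (ca_coact a) : tensor_dg V O)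
               (tmap e1 id (hc_Delta (val th)))).
rewrite (dgm_mul EM) ver_emb_tensor_in.
have -> : ver_emb_tensor (tmap e1 id (hc_Delta (val th))) = tens 1 (hc_Delta (val th)).
  rewrite -[in RHS](hc_Delta_coinv (val_lcoinv th)) /ver_emb_tensor tmap_comp; try lin.
  move: (hc_Delta (val th) : tensor O O).
  apply: linear_tensor_ext => [||w v]; [lin|lin|].
  rewrite !tmap_tens; try lin.
  rewrite /e1 ver_emb_tens val_to_coinv_proj form_coact1.
  by rewrite (dga_mul1 (dga_ax (tensor_dga A0 O))) tassoc_tens.
have DM : dg_morphism (tmap id (@hc_Delta k H O) : tensor_dg A0 O -> T2).
  exact: (@tmap_dg_morphism k A0 O A0 (tensor_dga O O) _ _
    (dg_morphism_id _) (hc_Delta_morph O)).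
rewrite /ver_Delta ver_emb_in ver_emb_tens (dgm_mul DM); congr dg_mul.
by rewrite tmap_tens; try lin.
Qed.

Lemma ver_coact_dg_morphism : dg_morphism ver_coact.
Proof.
apply: (dg_morphism_cancel ver_emb_tensorK ver_emb_tensor_dg_morphism).
have e : (fun x => ver_emb_tensor (ver_coact x)) = ver_Delta.
  by apply/funext => x; exact: ver_emb_coact.
rewrite e; exact: ver_Delta_dg_morphism.
Qed.

Lemma ver_coact_in a :
  ver_coact (ver_in O a) = tmap (@ver_in k H O A : A -> V) (hc_in O) (ca_coact a).
Proof. by rewrite /ver_coact -ver_emb_tensor_in ver_emb_tensorK. Qed.

End Vertical.

Theorem proposition4p2p9 (k : fieldType) (H : hopfAlgebra k)
    (O : hopfCalculus H) (A : comodAlgebra H) (qpb : quantum_principal_bundle A)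
    (OA : calculus A) (hOA : complete O (cal_in OA)) :
  exists Dver : ver_dg O A -> tensor_dg (ver_dg O A) O,
    coaction_extension O (@ver_in k H O A) Dver /\
    forall (DA : OA -> tensor_dg OA O) (pi_ver : OA -> ver_dg O A),
      coaction_extension O (cal_in OA) DA -> is_pi_ver O OA pi_ver ->
      forall w, Dver (pi_ver w) = tmap pi_ver id (DA w).
Proof.
exists (@ver_coact k H O A); split.
  split; [exact: ver_coact_dg_morphism|exact: ver_coact_in].
move=> DA pi_ver [DAM DAE] [piM _ piE].
have iL := cal_linear (cal_ax OA); have piL := dgm_linear piM.
apply: (calculus_morphism_ext (cal_ax OA) (f := fun w => ver_coact (pi_ver w))
  (g := fun w => tmap pi_ver id (DA w) : tensor_dg (ver_dg O A) O)).
- exact: dg_morphism_comp (ver_coact_dg_morphism O A) piM.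
- apply: dg_morphism_comp DAM.
  exact: (@tmap_dg_morphism k OA O (ver_dga O A) O _ _ piM (dg_morphism_id _)).
move=> a; rewrite piE ver_coact_in DAE tmap_comp //.
- by apply: eq_tmap => // b; rewrite piE.
- exact: hc_in_linear.
Qed.
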